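(* There is an absolute constant $C>0$ such that the following holds. Let $X$ be a nonempty countable set, let $n\ge 1$ be an integer, $\varepsilon\in(0,1]$, and let $\rho$ be a cost function on $X$ of degree $d$ with $2\le d<\infty$. Then for every integer $m\ge C\, n^4(\ln d)^2/\varepsilon^4$, every function $f:X^n\to\{0,1\}$ and every distribution $\mathcal D$ on $X$, $$\Big|\,\mathrm{ObliviousMax}_\rho(f,\mathcal D)-\mathrm{AdaptiveMax}_\rho(f\circ\Phi_{m\to n},\mathcal D)\Big|\le\varepsilon .$$ Equivalently: for any algorithm $A:X^n\to Y$, setting $A'=A\circ\Phi_{m\to n}$, for every test $T:Y\to\{0,1\}$ and every $\mathcal D$, $|\mathrm{ObliviousMax}_\rho(T\circ A,\mathcal D)-\mathrm{AdaptiveMax}_\rho(T\circ A',\mathcal D)|\le\varepsilon$.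
   Context: All distributions are discrete. A cost function on $X$ is a map $\rho:X\times X\to\mathbb R_{\ge0}\cup\{\infty\}$ with $\rho(x,x)=0$ for all $x$. Its degree is $\deg(\rho)=\sup_{x\in X}\#\{y\in X:\rho(x,y)\ne\infty\}$. For $S=(S_1,\dots,S_m)\in X^m$, $\mathcal C_\rho(S)=\{S'\in X^m:\frac1m\sum_{i=1}^m\rho(S_i,S'_i)\le1\}$. For a distribution $\mathcal D$ on $X$, $\mathcal C_\rho(\mathcal D)$ is the set of distributions $\mathcal D'$ on $X$ for which there is a coupling of $x\sim\mathcal D$ and $x'\sim\mathcal D'$ with $\mathbb E[\rho(x,x')]\le1$. The subsampling filter $\Phi_{m\to n}:X^m\to X^n$ ($n\le m$) is the randomized map that picks a uniformly random sequence $(i_1,\dots,i_n)$ of distinct indices in $[m]$ and outputs $(S_{i_1},\dots,S_{i_n})$. For a (possibly randomized) $g:X^m\to\{0,1\}$, $\mathrm{AdaptiveMax}_\rho(g,\mathcal D)=\mathbb E_{S\sim\mathcal D^m}\big[\sup_{S'\in\mathcal C_\rho(S)}\mathbb E[g(S')]\big]$ (inner expectation over the internal randomness of $g$). For $f:X^n\to\{0,1\}$, $\mathrm{ObliviousMax}_\rho(f,\mathcal D)=\sup_{\mathcal D'\in\mathcal C_\rho(\mathcal D)}\mathbb E_{S'\sim(\mathcal D')^n}[f(S')]$. *)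

(* Defs.v *)
From HB Require Import structures.
From mathcomp Require Import all_boot all_order all_algebra.
From mathcomp Require Import all_classical all_reals.
From mathcomp Require Import ereal esum exp.
Set Implicit Arguments. Unset Strict Implicit. Unset Printing Implicit Defensive.
Import Order.TTheory GRing.Theory Num.Theory.
Local Open Scope classical_set_scope.
Local Open Scope ring_scope.

Section Defs.
Context {R : realType} {T : countType}.

Definition is_distr (D : T -> R) : Prop :=
  (forall x, 0 <= D x) /\ (\esum_(x in [set: T]) (D x)%:E = 1)%E.

Definition is_cost (rho : T -> T -> \bar R) : Prop :=
  (forall x y, (0 <= rho x y)%E) /\ (forall x, rho x x = 0%E).

(* deg(rho) = d : the supremum over x of #{y | rho x y <> +oo} equals the
   natural number d, i.e. every such set has at most d elements and some x
   attains d.  Finite sets are listed by duplicate-free sequences. *)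
Definition cost_degree (rho : T -> T -> \bar R) (d : nat) : Prop :=
  (forall x (s : seq T), uniq s -> (forall y, y \in s -> rho x y != +oo%E) ->
     (size s <= d)%N) /\
  (exists x (s : seq T), [/\ uniq s, (forall y, y \in s -> rho x y != +oo%E)
     & size s = d]).

Definition cost_ball (rho : T -> T -> \bar R) (m : nat) (S S' : 'I_m -> T) : Prop :=
  ((m%:R^-1)%:E * \sum_(i < m) rho (S i) (S' i) <= 1)%E.

(* E_{S ~ D^k}[h S] for a nonnegative h *)
Definition prod_expect (D : T -> R) (k : nat) (h : ('I_k -> T) -> \bar R) : \bar R :=
  \esum_(S in [set: 'I_k -> T]) ((\prod_(i < k) D (S i))%:E * h S)%E.

(* AdaptiveMax_rho(g, D), where g : X^m -> {0,1} is randomized and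
   pg S = E[g(S)] is its acceptance probability (expectation over the
   internal randomness of g). *)
Definition AdaptiveMax (rho : T -> T -> \bar R) (m : nat)
  (pg : ('I_m -> T) -> R) (D : T -> R) : \bar R :=
  prod_expect D (fun S => ereal_sup [set (pg S')%:E | S' in cost_ball rho S]).

Definition coupling (D D' : T -> R) (pi : T -> T -> R) : Prop :=
  [/\ forall x y, 0 <= pi x y,
      forall x, (\esum_(y in [set: T]) (pi x y)%:E = (D x)%:E)%E
    & forall y, (\esum_(x in [set: T]) (pi x y)%:E = (D' y)%:E)%E].

Definition cost_ball_distr (rho : T -> T -> \bar R) (D D' : T -> R) : Prop :=
  is_distr D' /\ exists pi, coupling D D' pi /\
    (\esum_(p in [set: T * T]) ((pi p.1 p.2)%:E * rho p.1 p.2) <= 1)%E.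

Definition ObliviousMax (rho : T -> T -> \bar R) (n : nat)
  (f : ('I_n -> T) -> bool) (D : T -> R) : \bar R :=
  ereal_sup [set prod_expect D' (fun S => ((f S)%:R)%:E) | D' in cost_ball_distr rho D].

(* Pr[f(Phi_{m->n}(S)) = 1]: average of f over all sequences of n distinct
   indices (i_1,...,i_n) in [m], i.e. over injective maps 'I_n -> 'I_m. *)
Definition subsample_prob (n m : nat) (f : ('I_n -> T) -> bool) (S : 'I_m -> T) : R :=
  (\sum_(iota : {ffun 'I_n -> 'I_m} | injectiveb iota) (f (S \o iota))%:R)
  / #|[set iota : {ffun 'I_n -> 'I_m} | injectiveb iota]|%:R.

End Defs.

(* Main.v *)
Require Import Defs.
From HB Require Import structures.
From mathcomp Require Import all_boot all_order all_algebra fingroup perm.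
From mathcomp Require Import all_classical all_reals.
From mathcomp Require Import ereal esum sequences exp.
From mathcomp Require Import ring lra.
Import Order.TTheory GRing.Theory Num.Theory.
Local Open Scope classical_set_scope.
Local Open Scope ring_scope.
Set Implicit Arguments. Unset Strict Implicit. Unset Printing Implicit Defensive.

(* Oblivious <= adaptive: thin an oblivious coupling by a factor 1 - delta, with
   delta = eps / (8 n), and drop its moves of cost more than 1 / delta.  Corrupting
   the m sample points independently then respects the budget except with
   probability O(1 / (m delta^3)), and a subsample of an iid sample is iid.

   Adaptive <= oblivious: let S' be the adversary's answer to S and let
   Z_i = (S_(sigma i), S'_(sigma i)) for a uniform permutation sigma, so that Z is
   exchangeable.  The conditional entropies h_k = H(Z_k | Z_0 ... Z_(k-1)) are
   nonincreasing in k and, because S is iid and each S'_i has at most d possible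
   values given S_i, they drop by at most 2 ln d for k <= m/2.  Hence for some
   k = O(n^2 ln d / eps^2) the n variables following W = (Z_0, ..., Z_(k-1)) are,
   given W, eps-close to n independent copies of Z_k.  The same bounds show that W
   carries at most k ln d / (m - k) nats about S_k, so that, given W, the pair Z_k
   is close to a coupling of D with some D'.  Its conditional cost is at most
   m / (m - k) for every value of W, which a thinning brings back below 1. *)

(** * Sums of products and elementary inequalities *)

(** The corruptions S'_i depend on the whole sample, so the pairs (S_i, S'_i) are not independent.
    Draws from their empirical measure would be a cheap iid approximation, but for a D of large
    support the empirical measure of S is far from D and gives no coupling of D. Pinning only a few
    coordinates keeps D visible as the approximate law of the next sample point.

    Origin of the bound on m: each of the n independent copies may be off by about eps / n, so by
    Pinsker at most about eps^2 / n^2 nats about one S_i may be revealed. Near independence of n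
    coordinates takes about n ln d / eps^2 blocks of length n, whence k of order n^2 ln d / eps^2.
    Then k ln d / m <= eps^2 / n^2 forces m of order n^4 (ln d)^2 / eps^4.

    Errors are measured as mass lost in passing to a smaller submeasure. Mass lost from a coupling
    can stay in place at no cost, because rho vanishes on the diagonal, so a subcoupling always
    completes to an admissible coupling. *)

Section ProductSums.
Context {R : realType}.

Lemma sum_prod_ffun (I J : finType) (P : I -> pred J) (u : I -> J -> R) :
  \sum_(g : {ffun I -> J} | [forall i, P i (g i)]) \prod_i u i (g i) =
  \prod_i \sum_(j | P i j) u i j.
Proof.
rewrite (bigA_distr_big_dep P); apply: eq_bigl => g.
by apply/forallP/familyP => h i; have := h i.
Qed.

Lemma sum_prod_ffunT (I J : finType) (u : I -> J -> R) :
  \sum_(g : {ffun I -> J}) \prod_i u i (g i) = \prod_i \sum_j u i j.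
Proof. by rewrite bigA_distr_bigA. Qed.

(** A change of variables: images of independent points are independent. The weight [u] is not
    normalised, so thinned measures are covered as well. *)
Lemma sum_prod_push (Omega V : finType) n (phi : Omega -> V) (u : Omega -> R)
    (F : ('I_n -> V) -> R) :
  \sum_(w : {ffun 'I_n -> Omega}) (\prod_i u (w i)) * F (fun i => phi (w i)) =
  \sum_(g : {ffun 'I_n -> V}) (\prod_i \sum_(a | phi a == g i) u a) * F g.
Proof.
rewrite (partition_big (fun w : {ffun _ -> _} => [ffun i => phi (w i)] : {ffun 'I_n -> V}) predT) //=.
apply: eq_bigr => g _.
have E (w : {ffun 'I_n -> Omega}) :
    ([ffun i => phi (w i)] == g) = [forall i, phi (w i) == g i].
  apply/eqP/forallP => [<- i|h]; first by rewrite ffunE.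
  by apply/ffunP => i; rewrite ffunE; apply/eqP.
under eq_bigl do rewrite E.
rewrite -(sum_prod_ffun (fun i a => phi a == g i) (fun=> u)) mulr_suml.
apply: eq_bigr => w /forallP h; congr (_ * F _).
by apply/funext => i; apply/eqP.
Qed.

(** Each index outside the range of [iota] integrates out to a factor [\sum_v q v], which is 1. *)
Lemma sum_prod_subsample (V : finType) m n (q : V -> R) (iota : 'I_n -> 'I_m)
    (G : ('I_n -> V) -> R) :
  \sum_v q v = 1 -> injective iota ->
  \sum_(Y : {ffun 'I_m -> V}) (\prod_i q (Y i)) * G (Y \o iota) =
  \sum_(Y : {ffun 'I_n -> V}) (\prod_i q (Y i)) * G Y.
Proof.
move=> q1 iotaI.
rewrite (partition_big (fun Y : {ffun 'I_m -> V} => [ffun j => Y (iota j)] : {ffun 'I_n -> V}) predT) //=.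
apply: eq_bigr => g _.
pose P i v := [forall j, (iota j == i) ==> (v == g j)].
have E (Y : {ffun 'I_m -> V}) :
    ([ffun j => Y (iota j)] == g) = [forall i, P i (Y i)].
  apply/eqP/forallP => [gE i|h].
    by apply/forallP => j; apply/implyP => /eqP <-; rewrite -gE ffunE.
  by apply/ffunP => j; rewrite ffunE; have /forallP/(_ j) := h (iota j);
     rewrite eqxx => /eqP.
transitivity (\sum_(Y : {ffun 'I_m -> V} | [forall i, P i (Y i)]) (\prod_i q (Y i)) * G g).
  apply: eq_big => [Y|Y /eqP gE]; first exact: E.
  by congr (_ * G _); apply/funext => j; rewrite -gE ffunE.
rewrite -mulr_suml (sum_prod_ffun P (fun=> q)); congr (_ * _).
rewrite (bigID (fun i => i \in iota @: 'I_n)) /= [X in _ * X]big1 ?mulr1.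
  rewrite big_imset /=; last by move=> ? ? _ _; apply: iotaI.
  apply: eq_bigr => j _; rewrite (big_pred1 (g j)) // => v; apply/forallP/idP.
    by move/(_ j); rewrite eqxx.
  by move=> /eqP -> j'; apply/implyP => /eqP/iotaI ->.
move=> i ni; rewrite -[RHS]q1; apply: eq_bigl => v; apply/forallP => j.
by apply/implyP => /eqP ij; move: ni; rewrite -ij imset_f.
Qed.

Lemma expr_diff_le (a b : R) n : 0 <= a -> a <= b -> b <= 1 ->
  b ^+ n - a ^+ n <= n%:R * (b - a).
Proof.
move=> a0 ab b1; elim: n => [|n IH]; first by rewrite !expr0 mul0r subrr.
rewrite !exprS -natr1.
have an0 : 0 <= a ^+ n by apply: exprn_ge0.
have an1 : a ^+ n <= 1 by apply: exprn_ile1 => //; apply: le_trans b1.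
have anb : a ^+ n <= b ^+ n by apply: lerXn2r => //; rewrite nnegrE ?(le_trans a0).
have b0 : 0 <= b by apply: le_trans ab.
have h1 : b * (b ^+ n - a ^+ n) <= b ^+ n - a ^+ n by rewrite ler_piMl // subr_ge0.
have h2 : (b - a) * a ^+ n <= b - a by rewrite ler_piMr // subr_ge0.
lra.
Qed.

(** The price of thinning: the two product measures differ in total mass by the difference of two
    nth powers, and [F <= 1] turns lost mass into lost expectation. *)
Lemma sum_prod_diff (V : finType) n (u v : V -> R) (F : ('I_n -> V) -> R) :
  (forall a, 0 <= u a) -> (forall a, u a <= v a) -> \sum_a v a <= 1 ->
  (forall g, F g <= 1) ->
  \sum_(g : {ffun 'I_n -> V}) (\prod_i v (g i)) * F g <=
  \sum_(g : {ffun 'I_n -> V}) (\prod_i u (g i)) * F g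
    + n%:R * (\sum_a v a - \sum_a u a).
Proof.
move=> u0 uv v1 F1; rewrite -lerBlDl -sumrB.
apply: (@le_trans _ _ (\sum_(g : {ffun 'I_n -> V}) (\prod_i v (g i) - \prod_i u (g i)))).
  apply: ler_sum => g _; rewrite -mulrBl ler_piMr // subr_ge0.
  by apply: ler_prod => i _; rewrite u0 uv.
rewrite sumrB (sum_prod_ffunT (fun _ : 'I_n => v)) (sum_prod_ffunT (fun _ : 'I_n => u)).
rewrite !prodr_const card_ord; apply: expr_diff_le => //.
  by apply: sumr_ge0.
by apply: ler_sum.
Qed.

Lemma ln_le_subr1 (x : R) : 0 < x -> ln x <= x - 1.
Proof. by move=> x0; have := @le_ln1Dx R (x - 1); rewrite subrKC; apply; lra. Qed.

(** Integrated, this becomes Pinsker's inequality. With [u] the square root of [r], the bound ln u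
    <= u - 1 gives the Hellinger estimate (1 - u)^2 <= r - 1 - ln r; the factorisation 1 - r = (1 -
    u)(1 + u) and the weighted AM-GM inequality do the rest. *)
Lemma pinsker_pointwise (r lam : R) : 0 < r -> 0 < lam ->
  1 - Num.min 1 r <= (r - 1 - ln r) / lam + lam * (1 + r) / 2.
Proof.
move=> r0 l0; set u := Num.sqrt r.
have u0 : 0 < u by rewrite sqrtr_gt0.
have rE : r = u ^+ 2 by rewrite sqr_sqrtr // ltW.
have lnE : ln r = ln u + ln u by rewrite rE expr2 lnM // posrE.
have lnu := ln_le_subr1 u0.
have h1 : (1 - u) ^+ 2 <= r - 1 - ln r by rewrite lnE rE; lra.
have h2 : (1 - u) ^+ 2 / lam <= (r - 1 - ln r) / lam.
  by rewrite ler_pM2r ?invr_gt0.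
apply: le_trans (lerD h2 (lexx _)).
have h3 : 1 - u ^+ 2 <= (1 - u) ^+ 2 / lam + lam * (1 + r) / 2.
  have : 0 <= ((1 - u) - lam * (1 + u) / 2) ^+ 2 / lam.
    by rewrite mulr_ge0 ?invr_ge0 ?sqr_ge0 ?ltW.
  have -> : ((1 - u) - lam * (1 + u) / 2) ^+ 2 / lam =
     (1 - u) ^+ 2 / lam - (1 - u ^+ 2) + lam * (1 + u) ^+ 2 / 4.
    by field; rewrite gt_eqF.
  have : 0 <= lam * (1 - u) ^+ 2 by rewrite mulr_ge0 ?sqr_ge0 ?ltW.
  rewrite rE; lra.
have h4 : 0 <= (1 - u) ^+ 2 / lam + lam * (1 + r) / 2.
  apply: addr_ge0; first by rewrite mulr_ge0 ?invr_ge0 ?sqr_ge0 ?ltW.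
  by rewrite !mulr_ge0 ?invr_ge0 ?ltW // addr_gt0.
rewrite minEle; case: ifP => _; first by rewrite subrr.
by rewrite {1}rE.
Qed.

End ProductSums.

Lemma ln_ge_half (R : realType) (d : nat) : (1 < d)%N -> 1 / 2 <= ln d%:R :> R.
Proof.
move=> d1; have h : ln (2 : R) <= ln d%:R by rewrite ler_ln ?posrE ?ltr0n ?ler_nat // ltnW.
apply: le_trans h; have := @ln_le_subr1 R 2^-1; rewrite invr_gt0 ltr0n lnV ?posrE ?ltr0n //.
move=> /(_ isT); lra.
Qed.

(** * Entropy of random variables on a finite probability space *)

Section Entropy.
Context {R : realType} {Omega : finType} (P : Omega -> R).
Hypothesis P_gt0 : forall w, 0 < P w.
Hypothesis P_sum1 : \sum_w P w = 1.

(** The probability of the value of [X], read as a function on [Omega]. Entropies are then averages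
    over [Omega], and [X] may take values in any [eqType], finite or not. *)
Definition pr (A : eqType) (X : Omega -> A) (w : Omega) : R :=
  \sum_(w' | X w' == X w) P w'.

Definition ent (A : eqType) (X : Omega -> A) : R := - \sum_w P w * ln (pr X w).

Lemma pr_gt0 (A : eqType) (X : Omega -> A) w : 0 < pr X w.
Proof.
rewrite /pr (bigD1 w) //= ltr_wpDr ?P_gt0 // sumr_ge0 // => w' _.
exact/ltW.
Qed.

Lemma pr_eq (A : eqType) (X : Omega -> A) w w' : X w = X w' -> pr X w = pr X w'.
Proof. by rewrite /pr => ->. Qed.

(** Nonnegativity of relative entropy. The entropy inequalities below choose [r] as the likelihood
    ratio of a comparison law, of mass at most 1, to the true law. *)
Lemma gibbs (r : Omega -> R) : (forall w, 0 < r w) -> \sum_w P w * r w <= 1 ->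
  \sum_w P w * ln (r w) <= 0.
Proof.
move=> r0 r1; apply: (@le_trans _ _ (\sum_w P w * (r w - 1))).
  by apply: ler_sum => w _; rewrite ler_pM2l // ln_le_subr1.
under eq_bigr do rewrite mulrBr mulr1.
by rewrite sumrB P_sum1 subr_le0.
Qed.

(** Inside one atom of [X] the summands are conditional probabilities. This is the tool that bounds
    the mass of a likelihood ratio. *)
Lemma sum_class_le1 (A : eqType) (X : Omega -> A) (Q : pred Omega) :
  (forall w w', Q w -> Q w' -> X w = X w') -> \sum_(w | Q w) P w / pr X w <= 1.
Proof.
move=> QX; have [w0 Qw0|Q0] := pickP Q; last by rewrite big_pred0.
rewrite (eq_bigr (fun w => P w / pr X w0)); last first.
  by move=> w Qw; rewrite (pr_eq (QX _ _ Qw Qw0)).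
rewrite -mulr_suml ler_pdivrMr ?pr_gt0 // mul1r /pr.
rewrite [leRHS](bigID Q) /= (eq_bigl Q) => [|w].
  by rewrite lerDl sumr_ge0 // => w _; apply/ltW.
apply/andP/idP => [[]//|Qw]; split => //; exact/eqP/QX.
Qed.

(** The tower property of conditional expectation. *)
Lemma sum_class (A : eqType) (X : Omega -> A) (F : Omega -> R) :
  \sum_w P w * (\sum_(w' | X w' == X w) P w' / pr X w * F w') = \sum_w P w * F w.
Proof.
under eq_bigr do rewrite mulr_sumr.
rewrite (exchange_big_dep predT) //=; apply: eq_bigr => w' _.
rewrite (eq_bigr (fun w => P w / pr X w' * (P w' * F w'))); last first.
  by move=> w /eqP h; rewrite (pr_eq (esym h)); ring.
rewrite -mulr_suml -mulr_suml (eq_bigl (fun w => X w == X w')); last first.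
  by move=> w; rewrite eq_sym.
by rewrite -/(pr X w') divff ?mul1r // gt_eqF ?pr_gt0.
Qed.

Lemma ent_mono (A B : eqType) (X : Omega -> A) (Y : Omega -> B) :
  (forall w w', X w = X w' -> Y w = Y w') -> ent Y <= ent X.
Proof.
move=> XY; rewrite /ent lerN2; apply: ler_sum => w _; rewrite ler_pM2l //.
rewrite ler_ln ?posrE ?pr_gt0 // /pr [leRHS](bigID (fun w' => X w' == X w)) /=.
rewrite (eq_bigl (fun w' => (Y w' == Y w) && (X w' == X w))) => [|w'].
  by rewrite lerDl sumr_ge0 // => w' _; apply/ltW.
by case: (X w' =P X w) => [/XY ->|_]; rewrite ?eqxx ?andbT ?andbF.
Qed.

Lemma ent_equiv (A B : eqType) (X : Omega -> A) (Y : Omega -> B) :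
  (forall w w', X w = X w' <-> Y w = Y w') -> ent X = ent Y.
Proof.
by move=> XY; apply/eqP; rewrite eq_le !ent_mono // => w w' /XY.
Qed.

Lemma pr_act (A : eqType) (X : Omega -> A) (a : Omega -> Omega) w :
  injective a -> (forall w, P (a w) = P w) -> pr (X \o a) w = pr X (a w).
Proof.
move=> aI aP; rewrite /pr [RHS](reindex_inj aI) /=.
by apply: eq_bigr => w' _; rewrite aP.
Qed.

Lemma ent_act (A : eqType) (X : Omega -> A) (a : Omega -> Omega) :
  injective a -> (forall w, P (a w) = P w) -> ent (X \o a) = ent X.
Proof.
move=> aI aP; congr (- _); rewrite [RHS](reindex_inj aI) /=.
by apply: eq_bigr => w _; rewrite pr_act // aP.
Qed.

Lemma ent_const (A : eqType) (a : A) : ent (fun=> a) = 0.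
Proof.
rewrite /ent big1 ?oppr0 // => w _; rewrite /pr.
by under eq_bigl do rewrite eqxx; rewrite P_sum1 ln1 mulr0.
Qed.

Lemma ent_ratio (A B : eqType) (X : Omega -> A) (Y : Omega -> B) :
  \sum_w P w * ln (pr X w / pr Y w) = ent Y - ent X.
Proof.
rewrite /ent opprK addrC -sumrB; apply: eq_bigr => w _.
by rewrite ln_div ?posrE ?pr_gt0 // mulrBr.
Qed.

(** Here [r] compares the law making [X] and [Y] conditionally independent given [W] with the true
    law. Its mass may fall below 1, since the former can charge triples that never occur. *)
Lemma ent_submod (A B C : eqType) (X : Omega -> A) (Y : Omega -> B) (W : Omega -> C) :
  ent (fun w => (X w, Y w, W w)) + ent W <=
  ent (fun w => (X w, W w)) + ent (fun w => (Y w, W w)).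
Proof.
set XW := fun w => (X w, W w); set YW := fun w => (Y w, W w).
set XYW := fun w => (X w, Y w, W w).
pose r w := (pr XW w / pr W w) * (pr YW w / pr XYW w).
have r0 w : 0 < r w by rewrite !mulr_gt0 ?invr_gt0 ?pr_gt0.
suff /(gibbs r0) : \sum_w P w * r w <= 1.
  rewrite (eq_bigr (fun w => P w * ln (pr XW w / pr W w) + P w * ln (pr YW w / pr XYW w))).
    by rewrite big_split /= !ent_ratio; lra.
  by move=> w _; rewrite /r lnM ?posrE ?divr_gt0 ?pr_gt0 // mulrDr.
have rE w : P w * r w = \sum_(w1 | XW w1 == XW w) \sum_(w2 | YW w2 == YW w)
     P w1 * P w2 / pr W w1 * (P w / pr XYW w).
  transitivity (\sum_(w1 | XW w1 == XW w) P w1 * (\sum_(w2 | YW w2 == YW w)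
     P w2 / pr W w * (P w / pr XYW w))).
    rewrite -!mulr_suml /r /pr; ring.
  apply: eq_bigr => w1 /eqP [_ h]; rewrite mulr_sumr; apply: eq_bigr => w2 _.
  by rewrite (pr_eq h); ring.
under eq_bigr do rewrite rE.
rewrite (exchange_big_dep predT) //=.
rewrite -P_sum1; apply: ler_sum => w1 _.
rewrite (exchange_big_dep (fun w2 => W w2 == W w1)) /=; last first.
  by move=> w w2 /eqP[_ ->] /eqP [_ ->].
apply: (@le_trans _ _ (\sum_(w2 | W w2 == W w1) P w1 * P w2 / pr W w1)).
  apply: ler_sum => w2 _; rewrite -mulr_sumr ler_piMr //.
    by rewrite !mulr_ge0 ?invr_ge0 ?ltW ?pr_gt0.
  apply: sum_class_le1 => w w' /andP[/eqP[h1 h2] /eqP[h3 h4]].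
  by move=> /andP[/eqP[h1' h2'] /eqP[h3' h4']]; rewrite /XYW -h1 -h3 -h2 h1' h2' h3'.
by rewrite -mulr_suml -mulr_sumr -/(pr W w1) mulfK // gt_eqF ?pr_gt0.
Qed.

(** The comparison law gives weight 1/d to each entry of the list [L (X w)]. *)
Lemma ent_fiber (A B : eqType) (X : Omega -> A) (Y : Omega -> B) (L : A -> seq B)
    (d : nat) : (0 < d)%N ->
  (forall a, (size (L a) <= d)%N) -> (forall w, Y w \in L (X w)) ->
  ent (fun w => (X w, Y w)) <= ent X + ln d%:R.
Proof.
move=> d0 Ld YL; set XY := fun w => (X w, Y w).
have dR : 0 < d%:R :> R by rewrite ltr0n.
pose r w := pr X w / pr XY w / d%:R.
have r0 w : 0 < r w by rewrite !mulr_gt0 ?invr_gt0 ?pr_gt0.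
suff /(gibbs r0) : \sum_w P w * r w <= 1.
  rewrite (eq_bigr (fun w => P w * ln (pr X w / pr XY w) - P w * ln d%:R)).
    by rewrite sumrB ent_ratio -mulr_suml P_sum1; lra.
  by move=> w _; rewrite /r ln_div ?posrE ?divr_gt0 ?pr_gt0 // mulrBr.
have -> : \sum_w P w * r w = \sum_w1 P w1 / d%:R * \sum_(w | X w == X w1) P w / pr XY w.
  under [RHS]eq_bigr do rewrite mulr_sumr.
  rewrite [RHS](exchange_big_dep predT) //=; apply: eq_bigr => w _.
  rewrite -mulr_suml -mulr_suml (eq_bigl (fun w1 => X w1 == X w)); last first.
    by move=> w'; rewrite eq_sym.
  by rewrite /r -/(pr X w); ring.
rewrite -[leRHS]P_sum1; apply: ler_sum => w1 _.
rewrite -mulrA; apply: ler_piMr; first exact/ltW.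
rewrite mulrC ler_pdivrMr // mul1r.
apply: (@le_trans _ _ (\sum_(y <- L (X w1)) \sum_(w | XY w == (X w1, y)) P w / pr XY w)).
  rewrite (exchange_big_dep (fun w => X w == X w1)) /=; last by move=> w y _ /eqP [->].
  apply: ler_sum => w /eqP wE.
  have := YL w; rewrite wE => /(big_rem _) ->; rewrite xpair_eqE wE !eqxx /=.
  rewrite lerDl sumr_ge0 // => b _; by rewrite ltW ?divr_gt0 ?pr_gt0.
apply: (@le_trans _ _ (\sum_(y <- L (X w1)) 1)).
  apply: ler_sum => y _; apply: sum_class_le1 => w w' /eqP h /eqP h'.
  by rewrite h h'.
have -> : \sum_(y <- L (X w1)) 1 = (size (L (X w1)))%:R :> R by rewrite -sum1_size natr_sum.
by rewrite ler_nat.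
Qed.

(** The ratio of the law of [W] times [D] to the law of [(W, X)]. As [T] may be infinite, [D] is
    declared a subprobability through duplicate-free lists. *)
Lemma sum_ratio_le1 (A T : eqType) (W : Omega -> A) (X : Omega -> T) (D : T -> R) :
  (forall t, 0 <= D t) -> (forall s, uniq s -> \sum_(t <- s) D t <= 1) ->
  \sum_w P w * (D (X w) * pr W w / pr (fun w => (W w, X w)) w) <= 1.
Proof.
move=> D0 D1; set WX := fun w => (W w, X w).
have -> : \sum_w P w * (D (X w) * pr W w / pr WX w) =
    \sum_w1 P w1 * \sum_(w | W w == W w1) P w / pr WX w * D (X w).
  under [RHS]eq_bigr do rewrite mulr_sumr.
  rewrite [RHS](exchange_big_dep predT) //=; apply: eq_bigr => w _.
  rewrite -mulr_suml (eq_bigl (fun w1 => W w1 == W w)); last first.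
    by move=> w'; rewrite eq_sym.
  by rewrite -/(pr W w); ring.
rewrite -[leRHS]P_sum1; apply: ler_sum => w1 _; apply: ler_piMr; first exact/ltW.
pose L := undup [seq X w | w : Omega].
apply: (le_trans _ (D1 L (undup_uniq _))).
apply: (@le_trans _ _ (\sum_(t <- L) \sum_(w | WX w == (W w1, t)) P w / pr WX w * D t)).
  rewrite (exchange_big_dep (fun w => W w == W w1)) /=; last by move=> w y _ /eqP [->].
  apply: ler_sum => w /eqP wE.
  have : X w \in L by rewrite mem_undup map_f ?mem_enum.
  move=> /(big_rem _) ->; rewrite xpair_eqE wE !eqxx /=.
  by rewrite lerDl sumr_ge0 // => b _; rewrite mulr_ge0 // ltW ?divr_gt0 ?pr_gt0.
apply: ler_sum => t _; rewrite -mulr_suml ler_piMl //.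
by apply: sum_class_le1 => w w' /eqP h /eqP h'; rewrite h h'.
Qed.

(** The left side is the mass lost by capping the likelihood ratio at 1. Leaving [lam] free instead
    of optimising it avoids a square root of the relative entropy. *)
Lemma pinsker (r : Omega -> R) (lam : R) : 0 < lam -> (forall w, 0 < r w) ->
  \sum_w P w * r w <= 1 ->
  \sum_w P w * (1 - Num.min 1 (r w)) <= - (\sum_w P w * ln (r w)) / lam + lam.
Proof.
move=> l0 r0 r1.
apply: (@le_trans _ _
  (\sum_w (P w * r w * (lam^-1 + lam / 2) + P w * (lam / 2 - lam^-1) - P w * ln (r w) / lam))).
  apply: ler_sum => w _.
  have -> : P w * r w * (lam^-1 + lam / 2) + P w * (lam / 2 - lam^-1) - P w * ln (r w) / lam
     = P w * ((r w - 1 - ln (r w)) / lam + lam * (1 + r w) / 2) by field; rewrite gt_eqF.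
  by rewrite ler_pM2l // pinsker_pointwise.
rewrite sumrB big_split /= -!mulr_suml P_sum1 mul1r.
have : (\sum_w P w * r w) * (lam^-1 + lam / 2) <= 1 * (lam^-1 + lam / 2).
  by apply: ler_wpM2r r1; rewrite addr_ge0 ?divr_ge0 ?invr_ge0 ?ltW.
lra.
Qed.

Lemma ent_cond_subadd (I A T : eqType) (W : Omega -> A) (X : I -> Omega -> T) (t : seq I) :
  ent (fun w => ([seq X i w | i <- t], W w)) <=
  ent W + \sum_(i <- t) (ent (fun w => (X i w, W w)) - ent W).
Proof.
elim: t => [|i t IH].
  rewrite big_nil addr0; apply: ent_mono => w w' /= ->; done.
rewrite big_cons.
have := ent_submod (X i) (fun w => [seq X i w | i <- t]) W.
have -> : ent (fun w => ([seq X i w | i <- i :: t], W w)) =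
   ent (fun w => (X i w, [seq X i w | i <- t], W w)).
  by apply: ent_equiv => w w' /=; split => [[-> -> ->]|[-> -> ->]].
lra.
Qed.

End Entropy.

(** * Product expectations over a countable set *)

Section CountableSums.
Context {R : realType}.
Local Open Scope ereal_scope.

Lemma esum_point (T : choiceType) (b0 : T) (c : \bar R) : 0 <= c ->
  \esum_(b in [set: T]) (if b == b0 then c else 0) = c.
Proof.
move=> c0; rewrite -[RHS](@esum_set1 R T b0 (fun=> c)) // [RHS]esum_mkcond.
apply: eq_esum => b _; rewrite -[in RHS](_ : (b == b0) = (b \in [set b0])) //.
by apply/eqP/idP => [->|]; rewrite inE.
Qed.

Lemma sum_seq_le_esum (T : choiceType) (a : T -> \bar R) (s : seq T) :
  uniq s -> \sum_(x <- s) a x <= \esum_(x in [set: T]) a x.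
Proof.
move=> us; apply: esum_ge; exists [set` s]; first by split.
by rewrite -fsbig_seq.
Qed.

Lemma esum_approx (T : choiceType) (a : T -> R) (c eta : R) :
  \esum_(x in [set: T]) (a x)%:E = c%:E -> (0 < eta)%R ->
  exists2 s : seq T, uniq s & (c - eta <= \sum_(x <- s) a x)%R.
Proof.
move=> ac eta0.
have : (c - eta)%:E < \esum_(x in [set: T]) (a x)%:E.
  by rewrite ac lte_fin ltrBlDr ltrDl.
move=> /ereal_sup_gt[_ [X [finX _] <-]].
rewrite fsbig_finite // sumEFin lte_fin => /ltW h.
by exists (finmap.enum_fset (fset_set X)) => //; exact: finmap.fset_uniq.
Qed.

Lemma sum_seq_le_cover (A : eqType) (a : A -> \bar R) (l : seq A) (V : finType)
    (e : V -> A) :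
  (forall x, 0 <= a x) -> uniq l -> (forall x, x \in l -> exists v, x = e v) ->
  \sum_(x <- l) a x <= \sum_v a (e v).
Proof.
move=> a0 ul cov.
apply: (@le_trans _ _ (\sum_(x <- l) \sum_(v | x == e v) a (e v))).
  rewrite big_seq [leRHS]big_seq; apply: lee_sum => x /cov[v ->].
  by rewrite (bigD1 v) //= leeDl // sume_ge0.
rewrite (exchange_big_dep predT) //=; apply: lee_sum => v _.
have [vl|vl] := boolP (e v \in l).
  rewrite -big_filter (_ : [seq x <- l | x == e v] = [:: e v]) ?big_seq1 //.
  by rewrite filter_pred1_uniq.
rewrite big_seq_cond big_pred0 => [|x]; first exact: a0.
by apply/negbTE; apply: contra vl => /andP[xl /eqP <-].
Qed.

Lemma sum_inj_le_esum (T : choiceType) (a : T -> \bar R) (V : finType) (e : V -> T) :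
  injective e -> \sum_v a (e v) <= \esum_(x in [set: T]) a x.
Proof.
move=> eI; have := @sum_seq_le_esum T a [seq e v | v : V].
by rewrite big_image /=; apply; rewrite map_inj_uniq ?enum_uniq.
Qed.

Section ProductExpectation.
Context {T : countType} (D : T -> R) (k : nat) (h : ('I_k -> T) -> \bar R).
Hypothesis D_ge0 : forall x, (0 <= D x)%R.
Hypothesis h_ge0 : forall S, 0 <= h S.

Lemma prod_expect_term_ge0 S : 0 <= (\prod_(i < k) D (S i))%:E * h S.
Proof. by rewrite mule_ge0 // lee_fin prodr_ge0. Qed.

Lemma prod_expect_ge (V : finType) (e : V -> T) : injective e ->
  \sum_(g : {ffun 'I_k -> V}) (\prod_i D (e (g i)))%:E * h (e \o g) <=
  prod_expect D h.
Proof.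
move=> eI; set a := fun S => (\prod_(i < k) D (S i))%:E * h S.
have a0 S : 0 <= a S by apply: prod_expect_term_ge0.
rewrite (eq_bigr (fun g : {ffun 'I_k -> V} =>
   \esum_(S in [set: 'I_k -> T]) (if S == e \o g then a (e \o g) else 0))); last first.
  by move=> g _; rewrite esum_point.
rewrite -esum_sum; last by move=> S g _ _; case: ifP.
apply: le_esum => S _; rewrite -big_mkcond /=.
have [g0 /eqP g0E|none] := pickP (fun g : {ffun 'I_k -> V} => S == e \o g).
  rewrite (big_pred1 g0) ?g0E // => g; apply/eqP/eqP => [|->//].
  move=> geq; apply/ffunP => i; apply: eI.
  by have := congr1 (fun f => f i) geq.
by rewrite big_pred0 //; exact: a0.
Qed.

(** Reduction to a finite alphabet, which may be assumed to contain any prescribed list [s0]; in the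
    applications [s0] carries almost all of the mass. *)
Lemma prod_expect_le (s0 : seq T) (M : \bar R) :
  (forall s : seq T, uniq s -> {subset s0 <= s} ->
    \sum_(g : {ffun 'I_k -> seq_sub s})
      (\prod_i D (@ssval T s (g i)))%:E * h (@ssval T s \o g) <= M) ->
  prod_expect D h <= M.
Proof.
move=> hM; set a := fun S => (\prod_(i < k) D (S i))%:E * h S.
have a0 S : 0 <= a S by apply: prod_expect_term_ge0.
apply: ge_ereal_sup => _ [X [finX _] <-]; rewrite fsbig_finite //.
pose l : seq ('I_k -> T) := finmap.enum_fset (fset_set X).
pose s := undup (s0 ++ flatten [seq [seq c i | i : 'I_k] | c <- l]).
apply: le_trans (hM s (undup_uniq _) _); last first.
  by move=> x xs0; rewrite mem_undup mem_cat xs0.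
have mem_s S i : S \in l -> S i \in s.
  move=> Sl; rewrite mem_undup mem_cat; apply/orP; right; apply/flattenP.
  exists [seq S i | i : 'I_k]; first by apply/mapP; exists S.
  by rewrite map_f ?mem_enum.
apply: (@sum_seq_le_cover _ a l _ (fun g : {ffun 'I_k -> seq_sub s} => @ssval T s \o g)) => //.
  exact: finmap.fset_uniq.
move=> S Sl; exists [ffun i => SeqSub (mem_s S i Sl)].
by apply/funext => i /=; rewrite ffunE.
Qed.

End ProductExpectation.

(** * Completing a finite subcoupling to a coupling *)

Section Lift.
Context {T : countType} (rho : T -> T -> \bar R) (D : T -> R).
Hypothesis rho_cost : is_cost rho.
Hypothesis D_distr : is_distr D.
Context {Omega : finType} (u : Omega -> R) (x y : Omega -> T).
Hypothesis u_ge0 : forall w, (0 <= u w)%R.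
Hypothesis u_row : forall t, (\sum_(w | x w == t) u w <= D t)%R.
Hypothesis u_cost : \sum_w (u w)%:E * rho (x w) (y w) <= 1.

Let rest t : R := (D t - \sum_(w | x w == t) u w)%R.
Let rest_ge0 t : (0 <= rest t)%R. Proof. by rewrite subr_ge0. Qed.

(* The mass of D left over by u stays in place, at no cost. *)
Let lift_pi a b : R :=
  (\sum_(w | (x w == a) && (y w == b)) u w + (if a == b then rest a else 0))%R.
Let lift_D b : R := (\sum_(w | y w == b) u w + rest b)%R.

Let lift_coupling : coupling D lift_D lift_pi.
Proof.
split=> [a b|a|b].
- by rewrite addr_ge0 ?sumr_ge0 //; case: ifP.
- rewrite (eq_esum (b := fun b => \sum_(w | x w == a) (if b == y w then (u w)%:E else 0) +
      (if b == a then (rest a)%:E else 0))); last first.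
    move=> b _; rewrite /lift_pi EFinD -sumEFin; congr (_ + _).
      by rewrite -big_mkcondr; apply: eq_bigl => w; rewrite [b == _]eq_sym.
    by rewrite eq_sym; case: ifP.
  rewrite esumD; first last.
  + by move=> b _; case: ifP => // _; rewrite lee_fin.
  + by move=> b _; apply: sume_ge0 => w _; case: ifP => // _; rewrite lee_fin.
  rewrite esum_sum; last by move=> b w _ _; case: ifP => // _; rewrite lee_fin.
  rewrite esum_point ?lee_fin //.
  rewrite (eq_bigr (fun w => (u w)%:E)); last by move=> w _; rewrite esum_point ?lee_fin.
  by rewrite sumEFin -EFinD /rest subrKC.
- rewrite (eq_esum (b := fun a => \sum_(w | y w == b) (if a == x w then (u w)%:E else 0) +
      (if a == b then (rest b)%:E else 0))); last first.
    move=> a _; rewrite /lift_pi EFinD -sumEFin; congr (_ + _).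
      by rewrite -big_mkcondr; apply: eq_bigl => w; rewrite [a == _]eq_sym andbC.
    by case: ifP => // /eqP ->.
  rewrite esumD; first last.
  + by move=> a _; case: ifP => // _; rewrite lee_fin.
  + by move=> a _; apply: sume_ge0 => w _; case: ifP => // _; rewrite lee_fin.
  rewrite esum_sum; last by move=> a w _ _; case: ifP => // _; rewrite lee_fin.
  rewrite esum_point ?lee_fin //.
  rewrite (eq_bigr (fun w => (u w)%:E)); last by move=> w _; rewrite esum_point ?lee_fin.
  by rewrite sumEFin -EFinD.
Qed.

Let esum_fiber (z : Omega -> T) :
  \esum_(b in [set: T]) (\sum_(w | z w == b) u w)%:E = (\sum_w u w)%:E.
Proof.
rewrite (eq_esum (b := fun b => \sum_w (if b == z w then (u w)%:E else 0))); last first.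
  by move=> b _; rewrite -sumEFin -big_mkcond; apply: eq_bigl => w; rewrite eq_sym.
rewrite esum_sum; last by move=> a w _ _; case: ifP => // _; rewrite lee_fin.
by rewrite -sumEFin; apply: eq_bigr => w _; rewrite esum_point ?lee_fin.
Qed.

Let lift_D_distr : is_distr lift_D.
Proof.
have D0 b : (0 <= lift_D b)%R by rewrite addr_ge0 ?sumr_ge0.
split=> //.
have U0 : (0 <= \sum_w u w)%R by apply: sumr_ge0.
(* [rest] contains a subtraction. Adding the x-marginal of [u] to both sides leaves only nonnegative
   sums, and the finite mass of [u] is cancelled at the end. *)
have : \esum_(b in [set: T]) ((lift_D b)%:E + (\sum_(w | x w == b) u w)%:E) =
       \esum_(b in [set: T]) ((D b)%:E + (\sum_(w | y w == b) u w)%:E).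
  apply: eq_esum => b _; rewrite -!EFinD /lift_D /rest; congr _%:E; lra.
have D0' := D_distr.1.
rewrite !esumD; try by move=> b _; rewrite lee_fin // sumr_ge0.
rewrite !esum_fiber D_distr.2 => h.
by move: h => /(congr1 (fun z => z - (\sum_w u w)%:E)); rewrite !addeK.
Qed.

Let lift_ball : cost_ball_distr rho D lift_D.
Proof.
split=> //; exists lift_pi; split=> //.
apply: le_trans u_cost.
rewrite (eq_esum (b := fun p => \sum_w (if p == (x w, y w) then (u w)%:E * rho (x w) (y w) else 0))).
  rewrite esum_sum; last first.
    by move=> p w _ _; case: ifP => // _; rewrite mule_ge0 ?lee_fin ?rho_cost.1.
  apply: lee_sum => w _; rewrite esum_point //.
  by rewrite mule_ge0 ?lee_fin ?rho_cost.1.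
move=> [a b] _ /=; rewrite /lift_pi EFinD ge0_muleDl ?lee_fin ?sumr_ge0 //; last by case: ifP.
have -> : (if a == b then rest a else 0%R)%:E * rho a b = 0.
  by case: eqP => [->|_]; rewrite ?rho_cost.2 ?mule0 ?mul0e.
rewrite adde0 -sumEFin ge0_sume_distrl; last by move=> w _; rewrite lee_fin.
rewrite -big_mkcond; apply: eq_big => [w|w /andP[/eqP -> /eqP ->] //].
by rewrite xpair_eqE ![_ == a]eq_sym ![_ == b]eq_sym.
Qed.

(** The marginal [lift_D] of the completed coupling dominates the image of [u] under [y], so the
    completion can only raise the acceptance probability. *)
Lemma subcoupling_le_ObliviousMax n (f : ('I_n -> T) -> bool) :
  (\sum_(g : {ffun 'I_n -> Omega}) (\prod_i u (g i)) * (f (fun i => y (g i)))%:R)%:E <=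
  ObliviousMax rho f D.
Proof.
apply: (@le_trans _ _ (prod_expect lift_D (fun S : 'I_n -> T => ((f S)%:R)%:E))); last first.
  by apply: ereal_sup_ubound; exists lift_D.
pose s := undup [seq y w | w : Omega].
have ys w : y w \in s by rewrite mem_undup map_f ?mem_enum.
pose phi w : seq_sub s := SeqSub (ys w).
apply: (le_trans _ (@prod_expect_ge T lift_D n _ lift_D_distr.1 _ (seq_sub s) (@ssval T s) _)).
- rewrite (_ : (\sum_g _)%R = \sum_(g : {ffun 'I_n -> Omega})
      (\prod_i u (g i)) * (f ((@ssval T s) \o (fun i => phi (g i))))%:R)%R //.
  rewrite (sum_prod_push phi u (fun S => (f ((@ssval T s) \o S))%:R)%R) -sumEFin.
  apply: lee_sum => g _; rewrite -EFinM lee_fin; apply: ler_wpM2r => //.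
  apply: ler_prod => i _; rewrite sumr_ge0 //=.
  rewrite -[leLHS]addr0 lerD //.
- by move=> S; rewrite lee_fin.
- exact: val_inj.
Qed.

End Lift.
End CountableSums.

(** * Subsampling and the adaptive supremum *)

Section Subsample.
Context {R : realType} {T : countType}.

Lemma card_inj_gt0 n m : (n <= m)%N ->
  (0 < #|[set iota : {ffun 'I_n -> 'I_m} | injectiveb iota]|)%N.
Proof.
move=> nm; apply/card_gt0P; exists [ffun i => widen_ord nm i].
rewrite inE; apply/injectiveP => i j; rewrite !ffunE => /(congr1 val) /= ij.
exact: val_inj.
Qed.

Lemma subsample_prob_ge0 n m (f : ('I_n -> T) -> bool) (S : 'I_m -> T) :
  0 <= subsample_prob f S :> R.
Proof. by rewrite divr_ge0 // sumr_ge0. Qed.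

Lemma subsample_prob_le1 n m (f : ('I_n -> T) -> bool) (S : 'I_m -> T) :
  subsample_prob f S <= 1 :> R.
Proof.
rewrite /subsample_prob; set c := #|_|.
have [->|c0] := posnP c; first by rewrite invr0 mulr0.
rewrite ler_pdivrMr ?ltr0n // mul1r /c -sum1_card natr_sum.
rewrite [leRHS](eq_bigl (fun iota : {ffun _ -> _} => injectiveb iota)); last first.
  by move=> i; apply/idP/idP => /asboolP.
by apply: ler_sum => i _; rewrite lern1 leq_b1.
Qed.

Lemma subsample_prob_expect (V : finType) (e : V -> T) (q : V -> R) n m
    (f : ('I_n -> T) -> bool) : \sum_v q v = 1 -> (n <= m)%N ->
  \sum_(Y : {ffun 'I_m -> V}) (\prod_i q (Y i)) * subsample_prob f (e \o Y) =
  \sum_(Y : {ffun 'I_n -> V}) (\prod_i q (Y i)) * (f (e \o Y))%:R.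
Proof.
move=> q1 nm; rewrite /subsample_prob; set c := #|_|.
have c0 : c%:R != 0 :> R by rewrite pnatr_eq0 -lt0n card_inj_gt0.
under eq_bigr do rewrite mulrA mulr_sumr.
rewrite -mulr_suml exchange_big /=.
set E := RHS.
rewrite (eq_bigr (fun=> E)); last first.
  move=> iota /injectiveP iI.
  exact: (@sum_prod_subsample R V m n q iota (fun Y => (f (e \o Y))%:R)).
rewrite sumr_const (_ : #|_| = c); last by apply: eq_card => i; apply/idP/idP => /asboolP.
by rewrite -(mulr_natr E) mulfK.
Qed.

End Subsample.

(** * The supremum over a cost ball as a real number *)

Section AdaptiveSup.
Context {R : realType} {T : countType} (rho : T -> T -> \bar R) (m : nat).
Context (pg : ('I_m -> T) -> R).
Hypothesis rho_cost : is_cost rho.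
Hypothesis pg_ge0 : forall S, 0 <= pg S.
Hypothesis pg_le1 : forall S, pg S <= 1.

Definition adaptive_sup (S : 'I_m -> T) : R :=
  fine (ereal_sup [set (pg S')%:E | S' in cost_ball rho S]).

Lemma cost_ball_refl (S : 'I_m -> T) : cost_ball rho S S.
Proof.
rewrite /cost_ball big1 ?mule0 ?lee_fin ?ler01 // => i _; exact: rho_cost.2.
Qed.

Lemma adaptive_supE S :
  ereal_sup [set (pg S')%:E | S' in cost_ball rho S] = (adaptive_sup S)%:E.
Proof.
rewrite /adaptive_sup fineK // fin_numElt; apply/andP; split.
  apply: (@lt_le_trans _ _ (pg S)%:E); first by rewrite ltNyr.
  by apply: ereal_sup_ubound; exists S => //; exact: cost_ball_refl.
apply: (@le_lt_trans _ _ 1%E); last by rewrite ltry.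
by apply: ge_ereal_sup => _ [S' _ <-]; rewrite lee_fin.
Qed.

Lemma le_adaptive_sup S S' : cost_ball rho S S' -> pg S' <= adaptive_sup S.
Proof.
by move=> SS'; rewrite -lee_fin -adaptive_supE; apply: ereal_sup_ubound; exists S'.
Qed.

Lemma adaptive_sup_ge0 S : 0 <= adaptive_sup S.
Proof. exact: le_trans (le_adaptive_sup (cost_ball_refl S)). Qed.

Lemma adaptive_sup_le1 S : adaptive_sup S <= 1.
Proof.
by rewrite -lee_fin -adaptive_supE; apply: ge_ereal_sup => _ [S' _ <-]; rewrite lee_fin.
Qed.

Lemma adaptive_sup_approx S (eta : R) : 0 < eta ->
  exists2 S', cost_ball rho S S' & adaptive_sup S <= pg S' + eta.
Proof.
move=> eta0; have := @ub_ereal_sup_adherent R [set (pg S')%:E | S' in cost_ball rho S] eta eta0.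
rewrite adaptive_supE => /(_ isT)[_ [S' SS' <-]].
by rewrite -EFinB lte_fin => /ltW h; exists S' => //; lra.
Qed.

Lemma AdaptiveMaxE (D : T -> R) :
  AdaptiveMax rho pg D = prod_expect D (fun S => (adaptive_sup S)%:E).
Proof. by rewrite /AdaptiveMax; congr prod_expect; apply/funext => S; rewrite adaptive_supE. Qed.

End AdaptiveSup.

(** * A tail bound for independent bounded costs *)

Section CostTail.
Context {R : realType}.

Lemma expR_le_quadratic (u : R) : 0 <= u -> u <= 1 / 2 ->
  expR u <= 1 + u + 2 * u ^+ 2.
Proof.
move=> u0 u1; have h := expR_ge1Dx (- u); rewrite expRN in h.
have e0 := expR_gt0 u.
have h1 : expR u * (1 - u) <= 1.
  by rewrite mulrC -ler_pdivlMr // mul1r.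
have h2 : 1 <= (1 + u + 2 * u ^+ 2) * (1 - u).
  have : 0 <= u ^+ 2 * (1 - 2 * u) by rewrite mulr_ge0 ?sqr_ge0 //; lra.
  have -> : u ^+ 2 * (1 - 2 * u) = (1 + u + 2 * u ^+ 2) * (1 - u) - 1 by ring.
  by rewrite subr_ge0.
have u2 : 0 < 1 - u by lra.
by rewrite -(ler_pM2r u2); apply: le_trans h2.
Qed.

(** A Chernoff bound with parameter [th]: the exponential moment factorises over the coordinates,
    and c^2 <= B c controls the quadratic term by the mean. The resulting exp(- m x) is weakened to
    1 / (m x), a rate that suffices. *)
Lemma sum_cost_tail (Z : finType) (p c : Z -> R) (B delta : R) (m : nat) :
  (forall z, 0 <= p z) -> \sum_z p z = 1 ->
  (forall z, 0 <= c z) -> (forall z, c z <= B) -> \sum_z p z * c z <= 1 - delta ->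
  0 < delta -> delta <= 1 -> 1 <= B -> (0 < m)%N ->
  \sum_(z : {ffun 'I_m -> Z}) (\prod_i p (z i)) * (m%:R < \sum_i c (z i))%R%:R <=
  8 * B / (m%:R * delta ^+ 2).
Proof.
move=> p0 p1 c0 cB pc d0 d1 B1 m0.
have B0 : 0 < B by lra.
have mR : 0 < m%:R :> R by rewrite ltr0n.
pose th := delta / (4 * B).
have th0 : 0 < th by rewrite divr_gt0 // mulr_gt0.
have thB : th * B = delta / 4 by rewrite /th; field; rewrite gt_eqF.
pose x := delta ^+ 2 / (8 * B).
have x0 : 0 < x by rewrite divr_gt0 ?exprn_gt0 ?mulr_gt0.
apply: (@le_trans _ _ (\sum_(z : {ffun 'I_m -> Z}) \prod_i (p (z i) * expR (th * (c (z i) - 1))))).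
  apply: ler_sum => z _; rewrite big_split /=; apply: ler_wpM2l.
    exact: prodr_ge0.
  rewrite -expR_sum; case: ltP => h /=; last exact: expR_ge0.
  rewrite -[leLHS]expR0 ler_expR -mulr_sumr mulr_ge0 ?ltW // sumrB sumr_const card_ord.
  by rewrite subr_gt0.
rewrite (sum_prod_ffunT (fun _ z => p z * expR (th * (c z - 1)))) prodr_const card_ord.
have step : \sum_z p z * expR (th * (c z - 1)) <= expR (- x).
  apply: (@le_trans _ _ (expR (- th) * (1 + (th + 2 * th ^+ 2 * B) * (1 - delta)))).
    apply: (@le_trans _ _ (expR (- th) * \sum_z (p z + (th + 2 * th ^+ 2 * B) * (p z * c z)))).
      rewrite mulr_sumr; apply: ler_sum => z _.
      have -> : th * (c z - 1) = - th + th * c z by ring.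
      rewrite expRD mulrCA ler_wpM2l ?expR_ge0 //.
      have tc : th * c z <= th * B by rewrite ler_pM2l.
      have tc0 : 0 <= th * c z by rewrite mulr_ge0 // ltW.
      have := @expR_le_quadratic (th * c z) tc0.
      have -> : th * c z <= 1 / 2 by lra.
      move=> /(_ isT) h; apply: (le_trans (ler_wpM2l (p0 z) h)).
      have : p z * (th * c z * (th * c z)) <= p z * (th * c z * (th * B)).
        by rewrite ler_wpM2l // ler_wpM2l.
      rewrite !expr2; lra.
    rewrite ler_wpM2l ?expR_ge0 // big_split /= p1 -mulr_sumr lerD2l.
    rewrite ler_wpM2l //; apply: addr_ge0; first exact: ltW.
    by rewrite mulr_ge0 ?(ltW B0) // mulr_ge0 ?sqr_ge0.
  apply: (@le_trans _ _ (expR (- th) * expR (th - x))); last first.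
    by rewrite -expRD; have -> : - th + (th - x) = - x by ring.
  rewrite ler_wpM2l ?expR_ge0 //; apply: le_trans (expR_ge1Dx _).
  rewrite lerD2l.
  have -> : x = th * delta / 2 by rewrite /x /th; field; rewrite gt_eqF.
  have -> : 2 * th ^+ 2 * B = 2 * th * (th * B) by ring.
  rewrite thB.
  have : 0 <= th * delta * delta by apply: mulr_ge0; [apply: mulr_ge0|]; exact: ltW.
  lra.
have s0 : 0 <= \sum_z p z * expR (th * (c z - 1)).
  by apply: sumr_ge0 => z _; rewrite mulr_ge0 ?expR_ge0.
apply: (le_trans (lerXn2r m _ _ step)); rewrite ?nnegrE ?expR_ge0 //.
rewrite -expRM_natl mulrN expRN.
have -> : 8 * B / (m%:R * delta ^+ 2) = (m%:R * x)^-1.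
  by rewrite /x; field; rewrite !gt_eqF.
have mx0 : 0 < m%:R * x by rewrite mulr_gt0.
rewrite lef_pV2 ?posrE ?expR_gt0 //.
by apply: le_trans (expR_ge1Dx _); rewrite lerDr.
Qed.

End CostTail.

(** * The oblivious maximum is at most the adaptive one *)

Section ObliviousLeAdaptive.
Context {R : realType} {T : countType} (rho : T -> T -> \bar R) (D : T -> R).
Context (n m : nat) (f : ('I_n -> T) -> bool).
Hypothesis rho_cost : is_cost rho.
Hypothesis D_ge0 : forall t, 0 <= D t.
Hypothesis m_gt0 : (0 < m)%N.
Hypothesis nm : (n <= m)%N.

Let ge0 (S : 'I_m -> T) := @subsample_prob_ge0 R T n m f S.
Let le1 (S : 'I_m -> T) := @subsample_prob_le1 R T n m f S.

(* The adversary corrupts the points of the sample independently according to p,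
   and leaves the sample untouched if this exceeds the budget. *)
Lemma iid_corruption_le_AdaptiveMax (V : finType) (e : V -> T) (p c : V * V -> R)
    (M B delta : R) :
  injective e -> 0 <= M -> (forall z, 0 <= p z) -> \sum_z p z = 1 ->
  (forall a, M * \sum_(z | z.1 == a) p z <= D (e a)) ->
  (forall z, 0 <= c z) -> (forall z, c z <= B) ->
  (forall z, 0 < p z -> rho (e z.1) (e z.2) = (c z)%:E) ->
  \sum_z p z * c z <= 1 - delta -> 0 < delta -> delta <= 1 -> 1 <= B ->
  ((M ^+ m * (\sum_(Y : {ffun 'I_n -> V}) (\prod_i \sum_(z | z.2 == Y i) p z) * (f (e \o Y))%:R
     - 8 * B / (m%:R * delta ^+ 2)))%:E <=
   AdaptiveMax rho (subsample_prob (m:=m) f) D)%E.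
Proof.
move=> eI M0 p0 p1 pD c0 cB pc cost d0 d1 B1.
rewrite (AdaptiveMaxE rho_cost le1).
set g := adaptive_sup rho (subsample_prob f).
have g0 S : 0 <= g S by exact: adaptive_sup_ge0 rho_cost ge0 le1 S.
apply: le_trans (prod_expect_ge D_ge0 _ eI); last by move=> S; rewrite lee_fin.
under [leRHS]eq_bigr do rewrite -EFinM.
rewrite sumEFin lee_fin.
apply: (@le_trans _ _ (M ^+ m * \sum_(S : {ffun 'I_m -> V})
    (\prod_i \sum_(z | z.1 == S i) p z) * g (e \o S))); last first.
  rewrite mulr_sumr; apply: ler_sum => S _; rewrite mulrA ler_wpM2r //.
  rewrite -[X in M ^+ X]card_ord -prodr_const -big_split /=.
  by apply: ler_prod => i _; rewrite pD mulr_ge0 // sumr_ge0.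
apply: ler_wpM2l; first exact: exprn_ge0.
rewrite -(sum_prod_push (n := m) fst p (fun S => g (e \o S))).
have q1 : \sum_v \sum_(z : V * V | z.2 == v) p z = 1.
  rewrite -p1 (exchange_big_dep predT) //=; apply: eq_bigr => z _.
  by rewrite (big_pred1 z.2) // => v; rewrite /= eq_sym.
rewrite -(subsample_prob_expect e f q1 nm).
rewrite -(sum_prod_push (n := m) snd p (fun S => subsample_prob f (e \o S))).
rewrite lerBlDr.
apply: le_trans (lerD (lexx _) (sum_cost_tail p0 p1 c0 cB cost d0 d1 B1 m_gt0)).
(* Both sides are now sums over sequences of pairs, compared termwise: over budget, the tail
   indicator is 1; within budget, the corrupted sample lies in the cost ball. *)
rewrite -big_split /=; apply: ler_sum => z _; rewrite -mulrDr.
have P0 : 0 <= \prod_(i < m) p (z i) by apply: prodr_ge0.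
(* [c] is the true cost only on pairs of positive mass. *)
have [->|Pn0] := eqVneq (\prod_(i < m) p (z i)) 0; first by rewrite !mul0r.
apply: ler_wpM2l => //; case: ltP => h /=.
  by apply: ler_wpDl; [exact: g0 | exact: le1].
rewrite addr0; apply: (le_adaptive_sup rho_cost le1).
rewrite /cost_ball /=.
rewrite (eq_bigr (fun i => (c (z i))%:E)) => [|i _]; last first.
  rewrite pc // lt_neqAle p0 andbT eq_sym; apply: contra Pn0 => /eqP pi0.
  by rewrite (bigD1 i) //= pi0 mul0r.
by rewrite sumEFin -EFinM lee_fin mulrC ler_pdivrMr ?ltr0n // mul1r.
Qed.

Lemma ObliviousMax_le_AdaptiveMax (eps : R) :
  is_distr D -> (0 < n)%N -> 0 < eps -> eps <= 1 ->
  2 ^+ 15 * n%:R ^+ 3 / eps ^+ 4 <= m%:R ->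
  (ObliviousMax rho f D <= AdaptiveMax rho (subsample_prob (m:=m) f) D + eps%:E)%E.
Proof.
move=> [_ D1] n0 e0 e1 mbig.
have nR : 0 < n%:R :> R by rewrite ltr0n.
have n1 : 1 <= n%:R :> R by rewrite ler1n.
have mR : 0 < m%:R :> R by rewrite ltr0n.
have m1 : 1 <= m%:R :> R by rewrite ler1n.
pose delta := eps / (8 * n%:R).
have d0 : 0 < delta by rewrite divr_gt0 // mulr_gt0.
have nd : n%:R * delta = eps / 8 by rewrite /delta; field; rewrite gt_eqF.
have d8 : delta <= 1 / 8 by rewrite ler_pdivrMr ?mulr_gt0 //; lra.
(* By Markov's inequality, pairs costing more than [B] carry mass at most [delta]. *)
pose B := delta^-1.
have B0 : 0 < B by rewrite invr_gt0.
have B1 : 1 <= B by rewrite invf_ge1 //; lra.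
have Bd : B * delta = 1 by rewrite mulVf // gt_eqF.
(* [eta] bounds the mass outside the finite alphabet; m * eta = delta / 2 keeps the chance that one
   of m sample points falls outside below delta / 2. *)
pose eta := delta / (2 * m%:R).
have eta0 : 0 < eta by rewrite divr_gt0 // mulr_gt0.
have meta : m%:R * eta = delta / 2 by rewrite /eta; field; rewrite gt_eqF.
have etad : eta <= delta / 2.
  by rewrite -meta ler_peMl // ltW.
(* Only half of the slack [delta] goes into the tail bound; the other half absorbs the normalisation
   by [M] below. *)
pose tau := 8 * B / (m%:R * (delta / 2) ^+ 2).
have tau_le : tau <= eps / 2.
  have -> : tau = 2 ^+ 14 * n%:R ^+ 3 / (eps ^+ 3 * m%:R).
    by rewrite /tau /B /delta; field; rewrite !gt_eqF.
  rewrite ler_pdivrMr ?mulr_gt0 ?exprn_gt0 //.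
  move: mbig; rewrite ler_pdivrMr ?exprn_gt0 // => mbig.
  have -> : eps / 2 * (eps ^+ 3 * m%:R) = m%:R * eps ^+ 4 / 2 by ring.
  lra.
apply: ge_ereal_sup => _ [D' [[D'0 D'1] [pi [[pi0 piD piD'] picost]]] <-].
have pisum : \esum_(z in [set: T * T]) (pi z.1 z.2)%:E = 1%E.
  transitivity (\esum_(x in [set: T]) \esum_(y in [set: T]) (pi x y)%:E)%E.
    rewrite (@esum_esum R T T setT (fun=> setT) (fun x y => (pi x y)%:E)).
      by congr esum; apply/seteqP; split.
    by move=> x y _ _; rewrite lee_fin.
  by under eq_esum do rewrite piD.
have [G uG Gbig] := @esum_approx R (T * T)%type (fun z => pi z.1 z.2) 1 eta pisum eta0.
apply: (@prod_expect_le R T D' n (fun S => ((f S)%:R)%:E) D'0 _ (map fst G ++ map snd G)).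
  by move=> S; rewrite lee_fin.
move=> s us Gs; set V := seq_sub s; pose e : V -> T := @ssval T s.
have eI : injective e by exact: val_inj.
have pair_eI : injective (fun z : V * V => (e z.1, e z.2)).
  by move=> [a b] [a' b'] /= [/eI -> /eI ->].
have piV : 1 - eta <= \sum_(z : V * V) pi (e z.1) (e z.2).
  apply: (le_trans Gbig); rewrite -lee_fin -!sumEFin.
  apply: (@sum_seq_le_cover R (T * T)%type (fun z => (pi z.1 z.2)%:E) G (V * V)%type
    (fun z => (e z.1, e z.2))) => //.
    by move=> z; rewrite lee_fin.
  move=> [a b] abG.
  have sa : a \in s by apply: Gs; rewrite mem_cat; apply/orP; left; apply/mapP; exists (a, b).
  have sb : b \in s by apply: Gs; rewrite mem_cat; apply/orP; right; apply/mapP; exists (a, b).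
  by exists (SeqSub sa, SeqSub sb).
have rowpi (a : V) : \sum_(b : V) pi (e a) (e b) <= D (e a).
  rewrite -lee_fin -piD -sumEFin.
  exact: (@sum_inj_le_esum R T (fun y => (pi (e a) y)%:E) V e eI).
have colpi (b : V) : \sum_(a : V) pi (e a) (e b) <= D' (e b).
  rewrite -lee_fin -piD' -sumEFin.
  exact: (@sum_inj_le_esum R T (fun x => (pi x (e b))%:E) V e eI).
have costV : (\sum_(z : V * V) (pi (e z.1) (e z.2))%:E * rho (e z.1) (e z.2) <= 1)%E.
  apply: le_trans picost.
  exact: (@sum_inj_le_esum R (T * T)%type (fun z => (pi z.1 z.2)%:E * rho z.1 z.2)%E _ _ pair_eI).
have D'V : \sum_(b : V) D' (e b) <= 1.
  rewrite -lee_fin -D'1 -sumEFin.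
  exact: (@sum_inj_le_esum R T (fun y => (D' y)%:E) V e eI).
pose M := \sum_(a : V) D (e a).
have M1 : M <= 1.
  rewrite -lee_fin -D1 -sumEFin.
  exact: (@sum_inj_le_esum R T (fun y => (D y)%:E) V e eI).
have Mbig : 1 - eta <= M.
  apply: (le_trans piV); rewrite -(pair_bigA _ (fun a b => pi (e a) (e b))) /=.
  exact: ler_sum.
have M0 : 0 < M by lra.
pose cheap (z : V * V) := (rho (e z.1) (e z.2) <= B%:E)%E.
pose c z := if cheap z then fine (rho (e z.1) (e z.2)) else 0.
have cE z : cheap z -> rho (e z.1) (e z.2) = (c z)%:E.
  move=> ch; rewrite /c ch fineK // ge0_fin_numE ?rho_cost.1 //.
  by apply: le_lt_trans ch _; rewrite ltry.
have c0 z : 0 <= c z.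
  by rewrite /c; case: ifP => // _; rewrite fine_ge0 // rho_cost.1.
have cB z : c z <= B.
  case ch : (cheap z); last by rewrite /c ch ltW.
  by rewrite -lee_fin -cE.
pose p0 z := if cheap z then (1 - delta) * pi (e z.1) (e z.2) else 0.
have p0_ge0 z : 0 <= p0 z.
  by rewrite /p0; case: ifP => // _; rewrite mulr_ge0 //; lra.
have p0_le z : p0 z <= pi (e z.1) (e z.2).
  rewrite /p0; case: ifP => // _; have := pi0 (e z.1) (e z.2) => h.
  by rewrite ler_piMl //; lra.
pose rest a := D (e a) - \sum_b p0 (a, b).
have rest0 a : 0 <= rest a.
  rewrite subr_ge0; apply: le_trans (rowpi a); apply: ler_sum => b _.
  exact: (p0_le (a, b)).
pose p z := (p0 z + (if z.1 == z.2 then rest z.1 else 0)) / M.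
have p_ge0 z : 0 <= p z.
  by rewrite mulr_ge0 ?invr_ge0 ?(ltW M0) // addr_ge0 //; case: ifP.
have prow a : \sum_(z | z.1 == a) p z = D (e a) / M.
  rewrite -mulr_suml; congr (_ / _).
  rewrite (reindex_onto (fun b : V => (a, b)) snd) /=; last by move=> [x y] /= /eqP ->.
  under eq_bigl do rewrite !eqxx.
  rewrite big_split /=; have -> : \sum_(b : V) (if a == b then rest a else 0) = rest a.
    by rewrite -big_mkcond (big_pred1 a) // => b; rewrite /= eq_sym.
  by rewrite /rest subrKC.
have psum : \sum_z p z = 1.
  rewrite (partition_big fst predT) //=.
  rewrite (eq_bigr _ (fun a _ => prow a)) -mulr_suml -/M divff // gt_eqF //.
have pcost : \sum_z p z * c z <= 1 - delta / 2.
  apply: (@le_trans _ _ ((1 - delta) / M)); last first.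
    rewrite ler_pdivrMr //.
    have : (1 - delta / 2) * (1 - delta / 2) <= (1 - delta / 2) * M.
      by apply: ler_wpM2l; lra.
    have : 0 <= delta * delta by rewrite mulr_ge0 // ltW.
    lra.
  rewrite (eq_bigr (fun z => (p0 z * c z) / M)); last first.
    move=> z _; rewrite /p; case: eqP => [zE|_]; last by rewrite addr0; ring.
    have -> : c z = 0.
      by rewrite /c; case: ifP => // _; rewrite zE rho_cost.2.
    by rewrite !mulr0 mul0r.
  rewrite -mulr_suml ler_wpM2r ?invr_ge0 ?(ltW M0) //.
  apply: (@le_trans _ _ ((1 - delta) * \sum_(z | cheap z) pi (e z.1) (e z.2) * c z)).
    rewrite mulr_sumr [leRHS]big_mkcond; apply: ler_sum => z _.
    by rewrite /p0; case: ifP => _; rewrite ?mul0r // mulrA.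
  rewrite ler_piMr //; first lra.
  rewrite -lee_fin -sumEFin; apply: le_trans costV.
  rewrite big_mkcond; apply: lee_sum => z _; case: ifP => ch; first by rewrite cE.
  by rewrite mule_ge0 ?lee_fin ?rho_cost.1.
have pdiag z : 0 < p z -> rho (e z.1) (e z.2) = (c z)%:E.
  case ch : (cheap z) => pz; first exact: cE.
  move: pz; rewrite /p /p0 ch add0r; case: eqP => [zE|_]; last by rewrite mul0r ltxx.
  by move: ch; rewrite /cheap zE rho_cost.2 lee_fin ltW.
have pD a : M * \sum_(z | z.1 == a) p z <= D (e a).
  by rewrite prow mulrC divfK // gt_eqF.
have := iid_corruption_le_AdaptiveMax eI (ltW M0) p_ge0 psum pD c0 cB pdiag pcost.
rewrite -/tau; set X := \sum_(Y : {ffun 'I_n -> V}) _.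
have -> : 0 < delta / 2 by lra.
have -> : delta / 2 <= 1 by lra.
move=> /(_ isT isT B1) XA.
(* [q] lies below [D'] and below the second marginal of [p], so it links the oblivious sample with
   the corrupted one. *)
set q := fun b : V => \sum_(a : V) p0 (a, b).
have qbig : (1 - delta) * (1 - eta - delta) <= \sum_b q b.
  rewrite /q exchange_big /= (pair_bigA _ (fun a b => p0 (a, b))) /=.
  apply: (@le_trans _ _ ((1 - delta) * \sum_(z | cheap z) pi (e z.1) (e z.2))); last first.
    rewrite mulr_sumr [leLHS]big_mkcond; apply: ler_sum => z _.
    by case: z => a b; rewrite /p0.
  apply: ler_wpM2l; first lra.
  suff : \sum_(z | ~~ cheap z) pi (e z.1) (e z.2) <= delta.
    have := piV; rewrite (bigID cheap) /=; lra.
  set E := \sum_(z | _) _.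
  have BE : B * E <= 1.
    rewrite -lee_fin mulr_sumr -sumEFin; apply: le_trans costV.
    rewrite big_mkcond; apply: lee_sum => z _; case: ifP => ch.
      rewrite EFinM muleC lee_wpmul2l ?lee_fin // ltW // ltNge.
      exact: ch.
    by rewrite mule_ge0 ?lee_fin ?rho_cost.1.
  have -> : E = delta * (B * E) by rewrite mulrA [delta * B]mulrC Bd mul1r.
  by rewrite ler_piMr // ltW.
have qX : \sum_(g : {ffun 'I_n -> V}) (\prod_i q (g i)) * (f (fun i => e (g i)))%:R <= X.
  apply: ler_sum => g _; apply: ler_wpM2r => //.
  apply: ler_prod => i _; rewrite sumr_ge0 //=.
  rewrite [leRHS](reindex_onto (fun a : V => (a, g i)) fst) /=; last by move=> [x y] /= /eqP ->.
  under [leRHS]eq_bigl do rewrite !eqxx.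
  apply: ler_sum => a _; rewrite /p.
  apply: (@le_trans _ _ (p0 (a, g i) / M)).
    by rewrite ler_peMr // invf_ge1.
  rewrite ler_wpM2r ?invr_ge0 ?(ltW M0) // lerDl; case: ifP => //.
have X1 : X <= 1.
  apply: (@le_trans _ _ (\sum_(Y : {ffun 'I_n -> V}) \prod_i \sum_(z | z.2 == Y i) p z)).
    apply: ler_sum => Y _; rewrite ler_piMr ?lern1 ?leq_b1 //.
    by apply: prodr_ge0 => i _; apply: sumr_ge0.
  rewrite (sum_prod_ffunT (fun (_ : 'I_n) v => \sum_(z : V * V | z.2 == v) p z)).
  rewrite big1 // => i _; rewrite -psum (exchange_big_dep predT) //=.
  by apply: eq_bigr => z _; rewrite (big_pred1 z.2) // => v; rewrite /= eq_sym.
have qD' b : q b <= D' (e b).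
  by apply: le_trans (colpi b); apply: ler_sum => a _; apply: (p0_le (a, b)).
have q0 b : 0 <= q b by apply: sumr_ge0.
have F1 (g : 'I_n -> V) : (f (fun i => e (g i)))%:R <= 1 :> R by rewrite lern1 leq_b1.
have HD' := @sum_prod_diff R V n q (fun b => D' (e b))
  (fun g => (f (fun i => e (g i)))%:R) q0 qD' D'V F1.
rewrite (eq_bigr (fun g : {ffun 'I_n -> V} =>
   ((\prod_i D' (e (g i))) * (f (fun i => e (g i)))%:R)%:E)); last first.
  by move=> g _; rewrite EFinM.
rewrite sumEFin.
apply: (@le_trans _ _ ((M ^+ m * (X - tau))%:E + eps%:E)%E); last by rewrite leeD2r.
rewrite -EFinD lee_fin.
have Mm : 1 - M ^+ m <= delta / 2.
  have := @expr_diff_le R M 1 m (ltW M0) M1 (lexx _); rewrite expr1n -meta => h.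
  by apply: (le_trans h); rewrite ler_pM2l //; lra.
have tau0 : 0 <= tau.
  by apply: divr_ge0; [rewrite mulr_ge0 // ltW | rewrite mulr_ge0 ?sqr_ge0].
have Mm1 : M ^+ m <= 1 by apply: exprn_ile1 => //; apply: ltW.
have h1 : (1 - M ^+ m) * (X - tau) <= delta / 2.
  apply: le_trans Mm; rewrite ler_piMr //; lra.
have h2 : n%:R * (\sum_(b : V) D' (e b) - \sum_b q b) <= n%:R * (2 * delta + eta).
  rewrite ler_pM2l //.
  have : 0 <= delta * (eta + delta) by rewrite mulr_ge0 ?addr_ge0 // ltW.
  lra.
have h3 : n%:R * eta <= n%:R * (delta / 2) by rewrite ler_pM2l.
have h4 : delta <= n%:R * delta by rewrite ler_peMl // ltW.
lra.
Qed.

End ObliviousLeAdaptive.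

(** * Exchangeable families *)

Lemma perm_extend_seq (I : finType) (s t : seq I) : uniq s -> uniq t -> size s = size t ->
  exists tau : {perm I}, [seq tau i | i <- s] = t.
Proof.
elim: s t => [|i s IH] [|j t] //=; first by move=> _ _ _; exists 1%g.
move=> /andP[ins us] /andP[jnt ut] [/(IH _ us ut)[tau tauE]].
exists (tau * tperm (tau i) j)%g; rewrite permM tpermL; congr (_ :: _).
rewrite -tauE; apply/eq_in_map => k ks; rewrite permM tpermD //.
  by apply: contraNneq ins => /perm_inj ->.
by apply: contraNneq jnt => ->; rewrite -tauE map_f.
Qed.

Lemma exists_small_increment (R : realType) (a : nat -> R) (L : nat) : (0 < L)%N ->
  exists2 l, (l < L)%N & a l - a l.+1 <= (a 0%N - a L) / L%:R.
Proof.
move=> L0; apply: contrapT => no.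
have LR : 0 < L%:R :> R by rewrite ltr0n.
have : \sum_(0 <= l < L) (a 0%N - a L) / L%:R < \sum_(0 <= l < L) (a l - a l.+1).
  rewrite !big_mkord; apply: ltr_sum; first by apply/hasP; exists (Ordinal L0); rewrite ?mem_index_enum.
  move=> l _; rewrite ltNge; apply/negP => h; apply: no; exists (val l) => //.
  exact: ltn_ord.
rewrite sumr_const_nat subn0 -[_ *+ L]mulr_natr divfK ?gt_eqF //.
rewrite (eq_bigr (fun l => - (a l.+1 - a l))); last by move=> l _; rewrite opprB.
by rewrite sumrN telescope_sumr // opprB ltxx.
Qed.

Lemma ln_prod (R : realType) (I : finType) (F : I -> R) : (forall i, 0 < F i) ->
  ln (\prod_i F i) = \sum_i ln (F i).
Proof.
move=> F0; rewrite (eq_bigr (fun i => expR (ln (F i)))) => [|i _]; last first.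
  by rewrite lnK // posrE.
by rewrite -expR_sum expRK.
Qed.

Section Exchangeable.
Context {R : realType} {Omega : finType} (P : Omega -> R).
Hypothesis P_gt0 : forall w, 0 < P w.
Hypothesis P_sum1 : \sum_w P w = 1.
Context {m : nat} {A : eqType} (Z : 'I_m -> Omega -> A).
Context (act : {perm 'I_m} -> Omega -> Omega).
Hypothesis act_inj : forall tau, injective (act tau).
Hypothesis act_P : forall tau w, P (act tau w) = P w.
Hypothesis act_Z : forall tau i w, Z i (act tau w) = Z (tau i) w.

Local Notation ent := (ent P).

Definition joint (s : seq 'I_m) (w : Omega) : seq A := [seq Z i w | i <- s].

Lemma joint_act tau s w : joint s (act tau w) = joint [seq tau i | i <- s] w.
Proof. by rewrite /joint -map_comp; apply: eq_map => i; rewrite /= act_Z. Qed.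

(** By exchangeability the entropy of k distinct coordinates depends on k only; the first k serve as
    representatives. *)
Definition prefix_ent (k : nat) : R := ent (joint (take k (enum 'I_m))).

Lemma size_take_enum k : (k <= m)%N -> size (take k (enum 'I_m)) = k.
Proof. by move=> km; rewrite size_take_min size_enum_ord; apply/minn_idPl. Qed.

Lemma ent_joint s : uniq s -> ent (joint s) = prefix_ent (size s).
Proof.
move=> us; have sm : (size s <= m)%N by rewrite -(card_uniqP us) -[X in (_ <= X)%N]card_ord max_card.
have [] := perm_extend_seq us (take_uniq (size s) (enum_uniq 'I_m)).
  by rewrite size_take_enum.
move=> tau tauE; rewrite /prefix_ent -tauE -(ent_act (joint s) (@act_inj tau) (act_P tau)).
by congr ent; apply/funext => w /=; rewrite joint_act.
Qed.

Lemma prefix_ent0 : prefix_ent 0 = 0.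
Proof. by rewrite /prefix_ent take0; apply: ent_const. Qed.

Definition cond_ent (k : nat) : R := prefix_ent k.+1 - prefix_ent k.

(** Conditioning on one more coordinate lowers entropy, and by exchangeability it does not matter
    which coordinates are involved. The first k + 2 indices are split as [i], [j], [s]. *)
Lemma cond_ent_step k : (k.+2 <= m)%N -> cond_ent k.+1 <= cond_ent k.
Proof.
move=> km; pose l := take k.+2 (enum 'I_m).
have ul : uniq l by apply/take_uniq/enum_uniq.
have sl : size l = k.+2 by rewrite size_take_enum.
case: l ul sl => [|i [|j s]] //= /andP[ins /andP[jns us]] [sk].
have uis : uniq (i :: s) by rewrite /= us andbT; move: ins; rewrite inE negb_or => /andP[].
have ujs : uniq (j :: s) by rewrite /= jns.
have uijs : uniq (i :: j :: s) by rewrite /= ins jns.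
have := ent_submod P_gt0 P_sum1 (Z i) (Z j) (joint s).
have -> : ent (fun w => (Z i w, Z j w, joint s w)) = prefix_ent k.+2.
  rewrite -sk -(ent_joint uijs); apply: ent_equiv => // w w'.
  by rewrite /joint /=; split=> [[-> -> ->]|[-> -> ->]].
have -> : ent (fun w => (Z i w, joint s w)) = prefix_ent k.+1.
  rewrite -sk -(ent_joint uis); apply: ent_equiv => // w w'.
  by rewrite /joint /=; split=> [[-> ->]|[-> ->]].
have -> : ent (fun w => (Z j w, joint s w)) = prefix_ent k.+1.
  rewrite -sk -(ent_joint ujs); apply: ent_equiv => // w w'.
  by rewrite /joint /=; split=> [[-> ->]|[-> ->]].
rewrite (ent_joint us) sk /cond_ent; lra.
Qed.

Lemma cond_ent_antitone k j : (k + j < m)%N -> cond_ent (k + j) <= cond_ent k.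
Proof.
elim: j => [|j IH]; first by rewrite addn0.
rewrite addnS => kjm; apply: le_trans (IH (ltnW kjm)); exact: cond_ent_step.
Qed.

Lemma prefix_ent_ge k n j : (j <= n)%N -> (k + n < m)%N ->
  j%:R * cond_ent (k + n) <= prefix_ent (k + j) - prefix_ent k.
Proof.
move=> jn knm; elim: j jn => [|j IH] jn; first by rewrite mul0r addn0 subrr.
have := IH (ltnW jn).
have : cond_ent (k + n) <= cond_ent (k + j).
  have -> : (k + n = (k + j) + (n - j))%N by rewrite -addnA subnKC // ltnW.
  by apply: cond_ent_antitone; rewrite -addnA subnKC // ltnW.
rewrite addnS /cond_ent -natr1; lra.
Qed.

Lemma prefix_ent_le k j : (k + j <= m)%N ->
  prefix_ent (k + j) - prefix_ent k <= j%:R * cond_ent k.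
Proof.
elim: j => [|j IH] kjm; first by rewrite mul0r addn0 subrr.
rewrite addnS in kjm *; have := IH (ltnW kjm); have := cond_ent_antitone kjm.
rewrite /cond_ent -natr1; lra.
Qed.

End Exchangeable.

(** * Conditionally independent approximation of exchangeable variables *)

Section IidApproximation.
Context {R : realType} {Omega : finType} (P : Omega -> R).
Hypothesis P_gt0 : forall w, 0 < P w.
Hypothesis P_sum1 : \sum_w P w = 1.

(** The conditional law given the value of [W] at [w], extended by 0 to all of [Omega] so that
    products range over one fixed type. *)
Definition cond_law (C : eqType) (W : Omega -> C) (w w' : Omega) : R :=
  if W w' == W w then P w' / pr P W w else 0.

Lemma cond_law_ge0 (C : eqType) (W : Omega -> C) w w' : 0 <= cond_law W w w'.
Proof. by rewrite /cond_law; case: ifP => // _; rewrite divr_ge0 ?ltW ?pr_gt0. Qed.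

Lemma cond_law_sum1 (C : eqType) (W : Omega -> C) w : \sum_w' cond_law W w w' = 1.
Proof. by rewrite -big_mkcond -mulr_suml divff // gt_eqF ?pr_gt0. Qed.

Context {m : nat} {A : eqType} (Z : 'I_m -> Omega -> A).
Context (act : {perm 'I_m} -> Omega -> Omega).
Hypothesis act_inj : forall tau, injective (act tau).
Hypothesis act_P : forall tau w, P (act tau w) = P w.
Hypothesis act_Z : forall tau i w, Z i (act tau w) = Z (tau i) w.

(** Given the coordinates in [s], the remaining ones are still exchangeable; this lets [i0] stand
    for all of them. *)
Lemma act_fix s i j : uniq s -> i \notin s -> j \notin s ->
  exists tau : {perm 'I_m}, tau i = j /\ forall w, joint Z s (act tau w) = joint Z s w.
Proof.
move=> us is_ js.
have [] := @perm_extend_seq _ (i :: s) (j :: s); rewrite /= ?is_ ?js //.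
move=> tau [tauij taus]; exists tau; split=> // w.
by rewrite (joint_act act_Z) taus.
Qed.

Context {n : nat} (s : seq 'I_m) (i0 : 'I_m) (a : 'I_n -> 'I_m).
Hypothesis n_gt0 : (0 < n)%N.
Hypothesis s_uniq : uniq s.
Hypothesis i0s : i0 \notin s.
Hypothesis a_inj : injective a.
Hypothesis as_ : forall j, a j \notin s.

Let W := joint Z s.
Let Za w := [seq Z (a j) w | j <- enum 'I_n].
Let ZaW w := (Za w, W w).
Let q j w := \sum_(w' | (W w' == W w) && (Z i0 w' == Z (a j) w)) P w'.
(** The likelihood ratio, conditionally on [W], of n independent copies of coordinate [i0] to the
    coordinates indexed by [a]. *)
Let r w := (\prod_j (q j w / pr P W w)) * (pr P W w / pr P ZaW w).

Let qE j w : q j w = pr P (fun w => (Z (a j) w, W w)) w.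
Proof.
have [tau [taui tauW]] := act_fix s_uniq i0s (as_ j).
rewrite /q (reindex_inj (@act_inj tau)) /=; apply: eq_big => w'.
  by rewrite act_Z taui /W tauW xpair_eqE andbC.
by rewrite act_P.
Qed.

Let r_gt0 w : 0 < r w.
Proof.
rewrite mulr_gt0 ?divr_gt0 ?pr_gt0 // prodr_gt0 // => j _.
by rewrite qE divr_gt0 ?pr_gt0.
Qed.

(** A change of measure. It is an inequality because independent copies may produce tuples of values
    that the true coordinates never take. *)
Let sum_r_le (G : ('I_n -> A) -> R) : (forall z, 0 <= G z) ->
  \sum_w P w * (r w * G (fun j => Z (a j) w)) <=
  \sum_w P w * \sum_(g : {ffun 'I_n -> Omega})
     (\prod_j cond_law W w (g j)) * G (fun j => Z i0 (g j)).
Proof.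
move=> G0.
pose C (g : {ffun 'I_n -> Omega}) w :=
  [forall j, (W (g j) == W w) && (Z i0 (g j) == Z (a j) w)].
have -> : \sum_w P w * (r w * G (fun j => Z (a j) w)) =
   \sum_(g : {ffun 'I_n -> Omega}) \sum_(w | C g w)
     (\prod_j (P (g j) / pr P W w)) * G (fun j => Z i0 (g j)) * pr P W w * (P w / pr P ZaW w).
  rewrite (exchange_big_dep predT) //=; apply: eq_bigr => w _.
  rewrite /r (eq_bigr (fun j => \sum_(w' | (W w' == W w) && (Z i0 w' == Z (a j) w)) P w' / pr P W w));
    last by move=> j _; rewrite /q mulr_suml.
  rewrite -(sum_prod_ffun (fun j w' => (W w' == W w) && (Z i0 w' == Z (a j) w))
              (fun _ w' => P w' / pr P W w)).
  rewrite !mulr_suml mulr_sumr; apply: eq_bigr => g /forallP h.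
  have -> : (fun j => Z i0 (g j)) = (fun j => Z (a j) w).
    by apply/funext => j; have /andP[_ /eqP] := h j.
  by rewrite /= -mulr_suml -/(pr P W w); ring.
under [leRHS]eq_bigr do rewrite mulr_sumr.
rewrite [leRHS]exchange_big /=; apply: ler_sum => g _.
have t0 w : 0 <= P w * ((\prod_j cond_law W w (g j)) * G (fun j => Z i0 (g j))).
  apply: mulr_ge0; first exact: ltW. rewrite mulr_ge0 // prodr_ge0 // => j _; exact: cond_law_ge0.
have [w1 Cw1|none] := pickP (C g); last by rewrite big_pred0 // sumr_ge0.
have Wg j : W (g j) = W w1 by have /forallP/(_ j)/andP[/eqP] := Cw1.
set K := (\prod_j (P (g j) / pr P W w1)) * G (fun j => Z i0 (g j)).
have K0 : 0 <= K.
  rewrite mulr_ge0 // prodr_ge0 // => j _; by rewrite divr_ge0 ?ltW ?pr_gt0.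
(* A tuple [g] determines the values of both [Za] and [W] on the event [C g], the latter through its
   first entry; hence that event lies in one atom of [ZaW]. *)
apply: (@le_trans _ _ (K * pr P W w1)).
  rewrite (eq_bigr (fun w => K * pr P W w1 * (P w / pr P ZaW w))); last first.
    move=> w /forallP Cw; have /andP[/eqP h _] := Cw (Ordinal n_gt0).
    have hW : W w = W w1 by rewrite -h Wg.
    by rewrite /K (pr_eq P hW).
  rewrite -mulr_sumr; apply: ler_piMr; first by apply: mulr_ge0 => //; exact/ltW/pr_gt0.
  apply: (sum_class_le1 P_gt0) => w w' /forallP Cw /forallP Cw'.
  rewrite /ZaW /Za; congr pair.
    apply/eq_map => j; have /andP[_ /eqP <-] := Cw j.
    by have /andP[_ /eqP <-] := Cw' j.
  have /andP[/eqP <- _] := Cw (Ordinal n_gt0).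
  by have /andP[/eqP <- _] := Cw' (Ordinal n_gt0).
apply: (@le_trans _ _ (\sum_(w | W w == W w1) P w * K)).
  by rewrite -mulr_suml mulrC.
rewrite [leRHS](bigID (fun w => W w == W w1)) /= -[leLHS]addr0 lerD ?sumr_ge0 //.
apply: ler_sum => w /eqP hW; rewrite ler_pM2l // ler_wpM2r //.
apply: ler_prod => j _; rewrite /cond_law Wg hW eqxx (pr_eq P hW) lexx andbT.
by apply/ltW/divr_gt0; [exact: P_gt0 | exact: pr_gt0].
Qed.

Let sum_r_le1 : \sum_w P w * r w <= 1.
Proof.
have := @sum_r_le (fun=> 1) (fun=> ler01).
under eq_bigr do rewrite mulr1; move=> /le_trans; apply.
rewrite -[leRHS]P_sum1; apply: ler_sum => w _; apply: ler_piMr; first exact: ltW.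
under eq_bigr do rewrite mulr1.
rewrite (sum_prod_ffunT (fun _ w' => cond_law W w w')) big1 // => j _.
exact: cond_law_sum1.
Qed.

Let ent_condE j : ent P (fun w => (Z (a j) w, W w)) = prefix_ent P Z (size s).+1.
Proof.
by rewrite -(@ent_joint R Omega P m A Z act act_inj act_P act_Z (a j :: s)) /= ?as_.
Qed.

Let ent_ZaW : ent P ZaW = prefix_ent P Z (size s + n).
Proof.
have -> : (size s + n)%N = size ([seq a j | j <- enum 'I_n] ++ s).
  by rewrite size_cat size_map size_enum_ord addnC.
rewrite -(@ent_joint R Omega P m A Z act act_inj act_P act_Z).
  apply: ent_equiv => // w w'; rewrite /joint /ZaW /Za /W /joint !map_cat -!map_comp.
  split=> [[-> ->] //|/eqP]; rewrite eqseq_cat ?size_map //.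
  by move=> /andP[/eqP h1 /eqP h2]; congr pair.
rewrite cat_uniq map_inj_uniq ?enum_uniq // s_uniq andbT /=.
by apply/hasPn => i is_; apply/negP => /mapP[j _ ij]; move: (as_ j); rewrite -ij is_.
Qed.

(** The conditional total correlation: n single conditional entropies minus the joint one. *)
Let tau := n%:R * cond_ent P Z (size s) - (prefix_ent P Z (size s + n) - prefix_ent P Z (size s)).

Let ln_r : \sum_w P w * ln (r w) = - tau.
Proof.
have entW : ent P W = prefix_ent P Z (size s).
  exact: (@ent_joint R Omega P m A Z act act_inj act_P act_Z s s_uniq).
rewrite (eq_bigr (fun w => \sum_j P w * ln (pr P (fun w => (Z (a j) w, W w)) w / pr P W w) +
    P w * ln (pr P W w / pr P ZaW w))) => [|w _].
  rewrite big_split /= exchange_big /= ent_ratio //.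
  rewrite (eq_bigr (fun=> - cond_ent P Z (size s))) => [|j _].
    by rewrite sumr_const card_ord -mulr_natl ent_ZaW entW /tau; ring.
  by rewrite ent_ratio // entW ent_condE /cond_ent; ring.
rewrite /r lnM ?posrE ?prodr_gt0 ?divr_gt0 ?pr_gt0 // => [|j _]; last first.
  by rewrite qE divr_gt0 ?pr_gt0.
rewrite mulrDr ln_prod => [|j]; last by rewrite qE divr_gt0 ?pr_gt0.
by rewrite mulr_sumr; congr (_ + _); apply: eq_bigr => j _; rewrite qE.
Qed.

(* Conditionally on the coordinates in s, the n coordinates indexed by a are close
   to n independent copies of the coordinate i0; their total correlation is the
   conditional-entropy defect in the numerator. *)
Lemma iid_approximation (G : ('I_n -> A) -> R) (lam : R) :
  (forall z, 0 <= G z) -> (forall z, G z <= 1) -> 0 < lam ->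
  \sum_w P w * G (fun j => Z (a j) w) <=
  \sum_w P w * (\sum_(g : {ffun 'I_n -> Omega})
     (\prod_j cond_law (joint Z s) w (g j)) * G (fun j => Z i0 (g j))) +
  (n%:R * cond_ent P Z (size s) -
     (prefix_ent P Z (size s + n) - prefix_ent P Z (size s))) / lam + lam.
Proof.
move=> G0 G1 l0.
have := pinsker P_gt0 P_sum1 l0 r_gt0 sum_r_le1; rewrite ln_r opprK => pk.
(* Pointwise, G <= r G + (1 - min(1, r)) because 0 <= G <= 1. *)
rewrite -addrA; apply: le_trans (lerD (sum_r_le G0) pk).
rewrite -big_split /=; apply: ler_sum => w _; rewrite -mulrDr ler_pM2l //.
set F := G _; have F0 : 0 <= F by apply: G0.
have F1 : F <= 1 by apply: G1.
rewrite minEle; case: ifP => h; first by rewrite subrr addr0 ler_peMl.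
have : (1 - r w) * F <= 1 - r w.
  by rewrite ler_piMr // subr_ge0 ltW // ltNge h.
lra.
Qed.

End IidApproximation.

(** * Corruption of an exchangeable sample *)

Section ExchangeableCorruption.
Context {R : realType} {T : countType} {Omega : finType} (P : Omega -> R).
Hypothesis P_gt0 : forall w, 0 < P w.
Hypothesis P_sum1 : \sum_w P w = 1.
Context {m : nat} (X Y : 'I_m -> Omega -> T).
Context (act : {perm 'I_m} -> Omega -> Omega).
Hypothesis act_inj : forall tau, injective (act tau).
Hypothesis act_P : forall tau w, P (act tau w) = P w.
Hypothesis act_X : forall tau i w, X i (act tau w) = X (tau i) w.
Hypothesis act_Y : forall tau i w, Y i (act tau w) = Y (tau i) w.

Context (D : T -> R).
Hypothesis D_ge0 : forall t, 0 <= D t.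
Hypothesis D_sub1 : forall s, uniq s -> \sum_(t <- s) D t <= 1.
Hypothesis D_gt0 : forall i w, 0 < D (X i w).
Hypothesis pr_X : forall w,
  pr P (fun w => [seq X i w | i <- enum 'I_m]) w <= \prod_i D (X i w).

Context (rho : T -> T -> \bar R) (c : 'I_m -> Omega -> R) (L : T -> seq T) (d : nat).
Hypothesis d_gt0 : (0 < d)%N.
Hypothesis L_size : forall t, (size (L t) <= d)%N.
Hypothesis Y_L : forall i w, Y i w \in L (X i w).
Hypothesis c_ge0 : forall i w, 0 <= c i w.
Hypothesis c_rho : forall i w, rho (X i w) (Y i w) = (c i w)%:E.
Hypothesis c_budget : forall w, \sum_i c i w <= m%:R.

Let Z i w := (X i w, Y i w).
Let act_Z tau i w : Z i (act tau w) = Z (tau i) w.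
Proof. by rewrite /Z act_X act_Y. Qed.

Let act_c tau i w : c i (act tau w) = c (tau i) w.
Proof. by apply: EFin_inj; rewrite -!c_rho act_X act_Y. Qed.

Let e := prefix_ent P Z.
Let joint_ent s : uniq s -> ent P (joint Z s) = e (size s).
Proof. exact: (@ent_joint R Omega P m _ Z act act_inj act_P act_Z s). Qed.

(** The cross-entropy of the law of [X i] relative to [D]. It replaces the entropy of [D], since the
    hypotheses only bound the joint law of the [X i] by the product of [D]. *)
Definition cross_ent (i : 'I_m) : R := - \sum_w P w * ln (D (X i w)).

Let cross_entE i j : cross_ent i = cross_ent j.
Proof.
rewrite /cross_ent (reindex_inj (@act_inj (tperm i j))) /=; congr (- _).
by apply: eq_bigr => w _; rewrite act_P act_X tpermL.
Qed.

(** The likelihood ratio of [D] to the conditional law of [X i] given [W]. *)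
Definition marginal_ratio (C : eqType) (W : Omega -> C) i w : R :=
  D (X i w) * pr P W w / pr P (fun w => (W w, X i w)) w.

Lemma marginal_ratio_gt0 (C : eqType) (W : Omega -> C) i w : 0 < marginal_ratio W i w.
Proof. by apply: divr_gt0; [apply: mulr_gt0; [exact: D_gt0|exact: pr_gt0]|exact: pr_gt0]. Qed.

Lemma ln_marginal_ratio (C : eqType) (W : Omega -> C) i :
  \sum_w P w * ln (marginal_ratio W i w) =
  ent P (fun w => (W w, X i w)) - ent P W - cross_ent i.
Proof.
rewrite -(ent_ratio P_gt0) /cross_ent opprK -big_split /=; apply: eq_bigr => w _.
rewrite /marginal_ratio -mulrA lnM ?posrE ?divr_gt0 ?pr_gt0 //; ring.
Qed.

Let ent_W_X (C : eqType) (W : Omega -> C) i :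
  ent P (fun w => (W w, X i w)) <= ent P W + cross_ent i.
Proof.
have := gibbs P_gt0 P_sum1 (@marginal_ratio_gt0 C W i) (sum_ratio_le1 P_gt0 P_sum1 W (X i) D_ge0 D_sub1).
rewrite ln_marginal_ratio; lra.
Qed.

Let e1_le i : e 1 <= cross_ent i + ln d%:R.
Proof.
have -> : e 1 = ent P (fun w => (X i w, Y i w)).
  rewrite -(@joint_ent [:: i]) //; apply: ent_equiv => // w w'.
  by rewrite /joint /Z /=; split=> [[-> ->]|[-> ->]].
apply: (le_trans (ent_fiber P_gt0 P_sum1 d_gt0 L_size (Y_L i))); rewrite lerD2r.
have := ent_W_X (fun=> tt) i; rewrite (ent_const P_sum1) add0r; apply: le_trans.
by apply: ent_mono => // w w' [].
Qed.

Let ent_all_X i : m%:R * cross_ent i <= ent P (fun w => [seq X i w | i <- enum 'I_m]).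
Proof.
have -> : m%:R * cross_ent i = - \sum_w P w * ln (\prod_i D (X i w)).
  under [in RHS]eq_bigr do rewrite ln_prod // mulr_sumr.
  rewrite exchange_big /= -sumrN (eq_bigr (fun=> cross_ent i)); last first.
    by move=> j _; rewrite -(cross_entE j).
  by rewrite sumr_const card_ord mulr_natl.
rewrite /ent lerN2; apply: ler_sum => w _; rewrite ler_pM2l //.
by rewrite ler_ln ?posrE ?pr_gt0 ?prodr_gt0.
Qed.

Let e_le k : (k <= m)%N -> e k <= k%:R * e 1.
Proof.
move=> km; have := @prefix_ent_le R Omega P P_gt0 P_sum1 m _ Z act act_inj act_P act_Z 0 k km.
by rewrite add0n /cond_ent (prefix_ent0 P_sum1) !subr0.
Qed.

Let e_all i : m%:R * cross_ent i <= e m.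
Proof.
apply: (le_trans (ent_all_X i)).
have -> : e m = ent P (joint Z (enum 'I_m)) by rewrite joint_ent ?enum_uniq // size_enum_ord.
apply: ent_mono => // w w' h; have := congr1 (map fst) h.
by rewrite /joint -!map_comp.
Qed.

(** With h the cross-entropy, [cond_ent P Z 0 <= h + ln d]. The total entropy is at least m h, of
    which the first K coordinates use at most K (h + ln d); spreading the remainder over m - K >= K
    coordinates leaves at least h - ln d for [cond_ent P Z K]. *)
Lemma cond_ent_drop K : (2 * K <= m)%N -> (0 < m)%N -> (K < m)%N ->
  cond_ent P Z 0 - cond_ent P Z K <= 2 * ln d%:R.
Proof.
move=> Km m0 Km'; pose i := Ordinal m0.
have h1 := e_all i; have h2 := e_le (ltnW Km'); have h3 := e1_le i.
have := @prefix_ent_le R Omega P P_gt0 P_sum1 m _ Z act act_inj act_P act_Z K (m - K).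
rewrite subnKC ?(ltnW Km') // leqnn => /(_ isT) h4.
have h5 : cond_ent P Z 0 <= cross_ent i + ln d%:R.
  by rewrite /cond_ent (prefix_ent0 P_sum1) subr0.
have KR : 0 <= K%:R :> R by [].
have mK : m%:R = K%:R + (m - K)%:R :> R by rewrite -natrD subnKC // ltnW.
have KmK : K%:R <= (m - K)%:R :> R by rewrite ler_nat leq_subRL ?(ltnW Km') // addnn -mul2n.
have mK0 : 0 < (m - K)%:R :> R by rewrite ltr0n subn_gt0.
have l0 : 0 <= ln d%:R :> R by rewrite ln_ge0 // ler1n.
have h6 : K%:R * e 1 <= K%:R * (cross_ent i + ln d%:R) by rewrite ler_wpM2l.
have h7 : K%:R * ln d%:R <= (m - K)%:R * ln d%:R :> R by rewrite ler_wpM2r.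
have h8 : (m - K)%:R * (cross_ent i - ln d%:R) <= (m - K)%:R * cond_ent P Z K.
  by move: h1 h2 h4; rewrite mK /e; lra.
rewrite ler_pM2l // in h8; lra.
Qed.

Section Conditioning.
Context (s : seq 'I_m) (i0 : 'I_m).
Hypothesis s_uniq : uniq s.
Hypothesis i0s : i0 \notin s.

Let W := joint Z s.
Let k := size s.
Let t := [seq i <- enum 'I_m | i \notin s].

Let size_t : size t = (m - k)%N.
Proof.
rewrite size_filter.
have := count_predC (mem s) (enum 'I_m); rewrite size_enum_ord.
have -> : count (mem s) (enum 'I_m) = k.
  rewrite -size_filter; apply/perm_size/uniq_perm => //; first exact/filter_uniq/enum_uniq.
  by move=> i; rewrite mem_filter mem_enum andbT.
move=> h; have -> : (m - k = (k + count (predC (mem s)) (enum 'I_m)) - k)%N by rewrite h.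
by rewrite addKn; apply: eq_count.
Qed.

Let km : (k < m)%N.
Proof.
by rewrite -subn_gt0 -size_t -has_predT; apply/hasP; exists i0; rewrite // mem_filter i0s mem_enum.
Qed.

Let mkE : m%:R = k%:R + (m - k)%:R :> R.
Proof. by rewrite -natrD subnKC // ltnW. Qed.

Let mk0 : 0 < (m - k)%:R :> R. Proof. by rewrite ltr0n subn_gt0. Qed.

(** All of S has entropy at least m times the cross-entropy, and [W] accounts for at most k times
    (cross-entropy + ln d). The m - k coordinates outside [s], equivalent given [W], share what is
    left. *)
Lemma marginal_information :
  (m - k)%:R * (ent P W + cross_ent i0 - ent P (fun w => (W w, X i0 w))) <=
  k%:R * ln d%:R.
Proof.
have h1 := ent_all_X i0; have h2 := e_le (ltnW km); have h3 := e1_le i0.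
have h4 := ent_cond_subadd P_gt0 P_sum1 W X t.
have h5 : ent P (fun w => [seq X i w | i <- enum 'I_m]) <=
          ent P (fun w => ([seq X i w | i <- t], W w)).
  apply: ent_mono => // w w' [ht hW]; apply/eq_in_map => i _.
  have [is_|is_] := boolP (i \in s).
    by move/eq_in_map: hW => /(_ i is_) [].
  by move/eq_in_map: ht => /(_ i); rewrite mem_filter is_ mem_enum; apply.
have h6 : \sum_(i <- t) (ent P (fun w => (X i w, W w)) - ent P W) =
          (m - k)%:R * (ent P (fun w => (W w, X i0 w)) - ent P W).
  rewrite big_seq (eq_bigr (fun=> ent P (fun w => (W w, X i0 w)) - ent P W)).
    by rewrite -big_seq -size_t big_const_seq iter_addr_0 count_predT mulr_natl.
  move=> i; rewrite mem_filter => /andP[is_ _]; congr (_ - _).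
  have [tau [taui tauW]] := act_fix act_Z s_uniq i0s is_.
  rewrite -(ent_act (fun w => (W w, X i0 w)) (@act_inj tau) (act_P tau)).
  by apply: ent_equiv => // w w'; rewrite /= !act_X taui /W !tauW; split=> [[-> ->]|[-> ->]].
have h7 : k%:R * e 1 <= k%:R * (cross_ent i0 + ln d%:R) by rewrite ler_wpM2l.
have h8 : ent P W = e k by rewrite joint_ent.
rewrite h6 in h4; rewrite mkE in h1; rewrite h8 in h4 *.
lra.
Qed.

(** The coordinates outside [s] have equal conditional cost, and together they never exceed the
    budget, whatever the value of [W]. *)
Lemma sum_cond_cost w :
  (m - k)%:R * \sum_w' cond_law P W w w' * c i0 w' <= m%:R.
Proof.
have ci i : i \in t -> \sum_w' cond_law P W w w' * c i w' = \sum_w' cond_law P W w w' * c i0 w'.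
  rewrite mem_filter => /andP[is_ _].
  have [tau [taui tauW]] := act_fix act_Z s_uniq i0s is_.
  rewrite [RHS](reindex_inj (@act_inj tau)) /=; apply: eq_bigr => w' _.
  by rewrite act_c taui /cond_law /W tauW act_P.
have -> : (m - k)%:R * (\sum_w' cond_law P W w w' * c i0 w') =
   \sum_w' cond_law P W w w' * \sum_(i <- t) c i w'.
  under [RHS]eq_bigr do rewrite mulr_sumr.
  rewrite exchange_big /= (eq_big_seq _ ci) big_const_seq iter_addr_0.
  by rewrite count_predT size_t mulr_natl.
rewrite -[leRHS]mul1r -[X in _ <= X * _](cond_law_sum1 P_gt0 W w) mulr_suml; apply: ler_sum => w' _.
rewrite ler_wpM2l ?(cond_law_ge0 P_gt0) //; apply: le_trans (c_budget w').
rewrite big_filter big_enum_cond /= [leRHS](bigID (fun i => i \notin s)) /=.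
by rewrite lerDl sumr_ge0.
Qed.

Context (n : nat) (a : 'I_n -> 'I_m) (f : ('I_n -> T) -> bool) (D0 : T -> R) (o delta : R).
Hypothesis n_gt0 : (0 < n)%N.
Hypothesis a_inj : injective a.
Hypothesis as_ : forall j, a j \notin s.
Hypothesis delta_gt0 : 0 < delta.
Hypothesis delta_le1 : delta <= 1.
Hypothesis D_D0 : forall t, (1 - delta) * D t <= D0 t.
Hypothesis oblivious : forall (u : Omega -> R) (x y : Omega -> T),
  (forall w, 0 <= u w) -> (forall t, \sum_(w | x w == t) u w <= D0 t) ->
  (\sum_w (u w)%:E * rho (x w) (y w) <= 1)%E ->
  \sum_(g : {ffun 'I_n -> Omega}) (\prod_i u (g i)) * (f (fun i => y (g i)))%:R <= o.
Hypothesis k_small : k%:R <= delta * m%:R.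

(** Capping by min(1, r) in [u] pushes the X-marginal of the conditional law below [D]. The factor 1
    - delta then pays both for passing from [D] to [D0] and for the conditional cost m / (m - k). *)
Let r := marginal_ratio W i0.
Let u w w' := (1 - delta) * (cond_law P W w w' * Num.min 1 (r w')).

Let min0 w : 0 <= Num.min 1 (r w).
Proof. by rewrite le_min ler01 ltW // marginal_ratio_gt0. Qed.

Let min1 w : Num.min 1 (r w) <= 1.
Proof. by rewrite ge_min lexx. Qed.

Let od : 0 <= 1 - delta. Proof. by rewrite subr_ge0. Qed.

Let u_ge0 w w' : 0 <= u w w'.
Proof. by rewrite !mulr_ge0 ?(cond_law_ge0 P_gt0). Qed.

Let u_row w x : \sum_(w' | X i0 w' == x) u w w' <= D0 x.
Proof.
apply: le_trans (D_D0 x); rewrite -mulr_sumr ler_wpM2l //.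
apply: (@le_trans _ _ (D x * \sum_(w' | (X i0 w' == x) && (W w' == W w))
    P w' / pr P (fun w => (W w, X i0 w)) w')).
  rewrite mulr_sumr [leRHS]big_mkcondr; apply: ler_sum => w' /eqP xE.
  rewrite /cond_law; case: eqP => [WE|_]; last by rewrite mul0r.
  apply: (@le_trans _ _ (P w' / pr P W w * r w')).
    rewrite ler_wpM2l ?ge_min ?lexx ?orbT //.
    by apply/ltW/divr_gt0; [exact: P_gt0|exact: pr_gt0].
  rewrite /r /marginal_ratio xE (pr_eq P WE) le_eqVlt; apply/orP; left; apply/eqP.
  by field; rewrite !gt_eqF ?pr_gt0.
rewrite ler_piMr //; apply: (sum_class_le1 P_gt0) => w1 w2.
by move=> /andP[/eqP -> /eqP ->] /andP[/eqP -> /eqP ->].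
Qed.

Let u_cost w : (\sum_w' (u w w')%:E * rho (X i0 w') (Y i0 w') <= 1)%E.
Proof.
rewrite (eq_bigr (fun w' => (u w w' * c i0 w')%:E)) => [|w' _]; last by rewrite c_rho EFinM.
rewrite sumEFin lee_fin.
apply: (@le_trans _ _ ((1 - delta) * \sum_w' cond_law P W w w' * c i0 w')).
  rewrite mulr_sumr; apply: ler_sum => w' _; rewrite /u -!mulrA ler_wpM2l //.
  rewrite ler_wpM2l ?(cond_law_ge0 P_gt0) // ler_piMl //.
rewrite -(ler_pM2l mk0) mulr1 mulrCA.
apply: (le_trans (ler_wpM2l od (sum_cond_cost w))).
by move: k_small; rewrite mkE; lra.
Qed.

Lemma corrupted_sample_le (lam lam' : R) : 0 < lam -> 0 < lam' ->
  \sum_w P w * (f (fun j => Y (a j) w))%:R <=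
  o + n%:R * (delta + k%:R * ln d%:R / (m - k)%:R / lam' + lam') +
  (n%:R * cond_ent P Z k - (prefix_ent P Z (k + n) - prefix_ent P Z k)) / lam + lam.
Proof.
move=> l0 l0'.
pose G (z : 'I_n -> T * T) : R := (f (snd \o z))%:R.
have G0 z : 0 <= G z by rewrite /G.
have G1 z : G z <= 1 by rewrite /G lern1 leq_b1.
have := @iid_approximation R Omega P P_gt0 P_sum1 m _ Z act act_inj act_P act_Z
  n s i0 a n_gt0 s_uniq i0s a_inj as_ G lam G0 G1 l0.
rewrite -/k => /le_trans; apply; rewrite !lerD2r.
(* For each value of [W] the n independent copies are thinned from the conditional law to [u], which
   is oblivious; the loss is n times the mass removed. *)
apply: (@le_trans _ _ (\sum_w P w * (o + n%:R * (1 - \sum_w' u w w')))).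
  apply: ler_sum => w _; rewrite ler_pM2l //.
  have h1 := oblivious (u_ge0 w) (u_row w) (u_cost w).
  have h2 := @sum_prod_diff R Omega n (u w) (cond_law P W w)
     (fun g => (f (fun j => Y i0 (g j)))%:R) (u_ge0 w).
  rewrite (cond_law_sum1 P_gt0) in h2; apply: le_trans (h2 _ _ _) _ => //.
  - move=> w'; rewrite /u mulrCA ler_piMr ?(cond_law_ge0 P_gt0) //.
    have := @mulr_ile1 R (1 - delta) (Num.min 1 (r w')) od (min0 w'); rewrite min1.
    have d1 : 1 - delta <= 1 by rewrite gerBl ltW.
    by rewrite d1; move=> /(_ isT isT).
  - by move=> g; rewrite lern1 leq_b1.
  - by rewrite lerD2r.
under eq_bigr do rewrite mulrDr.
rewrite big_split /= -mulr_suml P_sum1 mul1r lerD2l.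
under eq_bigr do rewrite mulrCA.
rewrite -mulr_sumr ler_wpM2l //.
under eq_bigr do rewrite mulrBr mulr1 -mulr_sumr mulrCA.
rewrite sumrB P_sum1 -mulr_sumr.
have -> : \sum_w P w * (\sum_w' cond_law P W w w' * Num.min 1 (r w')) =
          \sum_w P w * Num.min 1 (r w).
  rewrite -(sum_class P_gt0 W (fun w => Num.min 1 (r w))); apply: eq_bigr => w _.
  congr (_ * _); rewrite [RHS]big_mkcond; apply: eq_bigr => w' _.
  rewrite /cond_law; case: ifP => _; rewrite ?mul0r //.
have := pinsker P_gt0 P_sum1 l0' (@marginal_ratio_gt0 _ W i0)
   (sum_ratio_le1 P_gt0 P_sum1 W (X i0) D_ge0 D_sub1).
rewrite ln_marginal_ratio; under eq_bigr do rewrite mulrBr mulr1.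
rewrite sumrB P_sum1 -/r; set M := \sum_w _ => hM.
have M1 : M <= 1.
  rewrite -[leRHS]P_sum1; apply: ler_sum => w _; by rewrite ler_piMr // ltW.
have hI : - (ent P (fun w => (W w, X i0 w)) - ent P W - cross_ent i0) / lam' <=
     k%:R * ln d%:R / (m - k)%:R / lam'.
  rewrite ler_pM2r ?invr_gt0 // ler_pdivlMr // mulrC.
  apply: le_trans marginal_information; rewrite ler_pM2l //; lra.
have : delta * (1 - M) >= 0 by rewrite mulr_ge0 ?subr_ge0 // ltW.
lra.
Qed.

End Conditioning.
Lemma exists_close_sample (n : nat) (f : ('I_n -> T) -> bool) (D0 : T -> R) (o eps : R) :
  (0 < n)%N -> (1 < d)%N -> 0 < eps -> eps <= 1 ->
  2 ^+ 17 * n%:R ^+ 4 * (ln d%:R) ^+ 2 / eps ^+ 4 <= m%:R ->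
  (forall t, (1 - eps / (8 * n%:R)) * D t <= D0 t) ->
  (forall (u : Omega -> R) (x y : Omega -> T),
    (forall w, 0 <= u w) -> (forall t, \sum_(w | x w == t) u w <= D0 t) ->
    (\sum_w (u w)%:E * rho (x w) (y w) <= 1)%E ->
    \sum_(g : {ffun 'I_n -> Omega}) (\prod_i u (g i)) * (f (fun i => y (g i)))%:R <= o) ->
  exists2 a : 'I_n -> 'I_m, injective a &
    \sum_w P w * (f (fun j => Y (a j) w))%:R <= o + 3 / 4 * eps.
Proof.
move=> n0 d1 e0 e1 mbig D_D0 obl.
have nR : 1 <= n%:R :> R by rewrite ler1n.
have nR0 : 0 < n%:R :> R by rewrite ltr0n.
set l := ln d%:R in mbig *.
have l_half : 1 / 2 <= l by exact: ln_ge_half.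
have l0 : 0 < l by lra.
(* [x] is the number of blocks of length n for which an entropy drop of 2 l / x in one block gives a
   total correlation of n * (2 l / x) = eps^2 / 64. *)
pose x := 128 * n%:R * l / eps ^+ 2.
have e20 : 0 < eps ^+ 2 by apply: exprn_gt0.
have x1 : 1 <= x.
  rewrite ler_pdivlMr // mul1r.
  have h : 1 / 2 <= n%:R * l.
    by apply: (le_trans l_half); rewrite ler_peMl // ltW.
  have h' : eps ^+ 2 <= 1 by apply: exprn_ile1 => //; apply: ltW.
  lra.
pose N := (Num.truncn x).+1.
have xN : x <= N%:R by apply/ltW; rewrite truncnS_gt.
have Nx : N%:R <= 2 * x.
  rewrite /N -natr1; have := @truncn_le R x; rewrite (le_trans ler01 x1) => h; lra.
pose K := (N * n)%N.
pose y := 256 * n%:R ^+ 2 * l / eps ^+ 2.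
have Ky : K%:R <= y.
  rewrite /K natrM; have -> : y = 2 * x * n%:R by rewrite /y /x; field; rewrite gt_eqF.
  by rewrite ler_pM2r.
have y0 : 0 < y by rewrite !mulr_gt0 ?invr_gt0 ?exprn_gt0.
(* Since [y] bounds the number of pinned coordinates, the constant 2^17 arises as 512 * 256. *)
have ym : 512 * (n%:R / eps) ^+ 2 * l * y <= m%:R.
  apply: le_trans mbig; rewrite le_eqVlt; apply/orP; left; apply/eqP.
  by rewrite /y; field; rewrite gt_eqF.
pose z := n%:R / eps.
have z1 : 1 <= z by rewrite ler_pdivlMr // mul1r; lra.
have z0 : 0 < z by lra.
have Kzm : 256 * z * K%:R <= m%:R.
  apply: le_trans ym; rewrite -/z.
  have h1 : z * K%:R <= z * y by rewrite ler_pM2l.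
  have zy0 : 0 <= z * y by rewrite mulr_ge0 ?(ltW z0) ?(ltW y0).
  have h2 : z * y <= z * (z * y) by rewrite ler_peMl.
  have h3 : 1 / 2 * (z * (z * y)) <= l * (z * (z * y)).
    by rewrite ler_wpM2r // mulr_ge0 ?(ltW z0).
  rewrite expr2; lra.
have K0 : 0 <= K%:R :> R by [].
have Km256 : 256 * K%:R <= m%:R :> R.
  have h1 : K%:R <= z * K%:R by rewrite ler_peMl.
  lra.
have Kgt0 : (0 < K)%N by rewrite muln_gt0.
have Km2 : (2 * K < m)%N.
  rewrite -(ltr_nat R) natrM; have : 0 < K%:R :> R by rewrite ltr0n.
  lra.
have m0 : (0 < m)%N by apply: leq_trans Km2.
have Km : (K < m)%N by apply: leq_ltn_trans Km2; rewrite mul2n -addnn leq_addr.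
(* The total drop over N blocks is at most 2 l, so some block loses at most 2 l / N. Its start is
   the number k of pinned coordinates, and its n indices form the subsample [a]. *)
have [b bN hb] := exists_small_increment (fun b => cond_ent P Z (b * n)) (ltn0Sn (Num.truncn x)).
rewrite -/N -/K mul0n in bN hb.
pose k := (b * n)%N.
have kn : (k + n <= K)%N by rewrite /k /K addnC -mulSn leq_mul2r bN orbT.
have kK : (k <= K)%N by apply: leq_trans kn; rewrite leq_addr.
have knm : (k + n < m)%N by apply: leq_ltn_trans Km.
have drop : cond_ent P Z k - cond_ent P Z (k + n) <= 2 * l / N%:R.
  have -> : (k + n = b.+1 * n)%N by rewrite mulSn addnC.
  apply: (le_trans hb); rewrite ler_pM2r ?invr_gt0 ?ltr0n //.
  by apply: cond_ent_drop => //; apply: ltnW.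
have tau_le : n%:R * cond_ent P Z k - (prefix_ent P Z (k + n) - prefix_ent P Z k) <= eps ^+ 2 / 64.
  have h := @prefix_ent_ge R Omega P P_gt0 P_sum1 m _ Z act act_inj act_P act_Z k n n (leqnn n) knm.
  have h1 : n%:R * (cond_ent P Z k - cond_ent P Z (k + n)) <= n%:R * (2 * l / N%:R).
    by rewrite ler_pM2l.
  suff : n%:R * (2 * l / N%:R) <= eps ^+ 2 / 64 by lra.
  rewrite mulrA ler_pdivrMr ?ltr0n //.
  have -> : n%:R * (2 * l) = eps ^+ 2 / 64 * x by rewrite /x; field; rewrite gt_eqF.
  by rewrite ler_pM2l // divr_gt0.
have ajm (j : 'I_n) : (k + j < m)%N by apply: ltn_trans knm; rewrite ltn_add2l.
pose a j := Ordinal (ajm j).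
pose s := take k (enum 'I_m).
have km : (k <= m)%N by apply: ltnW; apply: leq_ltn_trans kK Km.
have ss : size s = k by rewrite size_take_enum.
have mem_s (i : 'I_m) : (i \in s) = (i < k)%N.
  rewrite -(mem_map val_inj) map_take val_enum_ord take_iota mem_iota /= add0n.
  by rewrite (minn_idPl km).
have as_ j : a j \notin s by rewrite mem_s /= -leqNgt leq_addr.
have aI : injective a.
  by move=> i j /(congr1 val) /= /addnI ij; apply: val_inj.
have us : uniq s by apply/take_uniq/enum_uniq.
exists a => //.
pose delta := eps / (8 * n%:R).
have d0 : 0 < delta by rewrite divr_gt0 // mulr_gt0.
have nd : n%:R * delta = eps / 8 by rewrite /delta; field; rewrite gt_eqF.
have dle : delta <= 1.
  by rewrite ler_pdivrMr ?mulr_gt0 //; lra.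
have kKR : k%:R <= K%:R :> R by rewrite ler_nat.
have ksmall : (size s)%:R <= delta * m%:R.
  rewrite ss; have -> : delta = (8 * z)^-1 by rewrite /delta /z; field; rewrite !gt_eqF.
  have z80 : 0 < 8 * z by lra.
  rewrite mulrC ler_pdivlMr //.
  have h : k%:R * z <= K%:R * z by rewrite ler_pM2r.
  have h' : 0 <= K%:R * z by rewrite mulr_ge0 // ltW.
  lra.
have e8 : 0 < eps / 8 by rewrite divr_gt0.
(* With lam = eps / 8 and lam' = delta the errors are 2 * eps / 8 from the correlation and n * 3
   delta = 3 eps / 8 from the marginals, together below 3 eps / 4. *)
have := @corrupted_sample_le s (a (Ordinal n0)) us (as_ _) n a f D0 o delta n0 aI as_ d0 dle D_D0 obl ksmall
  (eps / 8) delta e8 d0.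
rewrite ss -/l => /le_trans; apply.
have h1 : (n%:R * cond_ent P Z k - (prefix_ent P Z (k + n) - prefix_ent P Z k)) / (eps / 8) <= eps / 8.
  rewrite ler_pdivrMr //; apply: (le_trans tau_le); rewrite le_eqVlt; apply/orP; left; apply/eqP; by field.
have mk0 : 0 < (m - k)%:R :> R by rewrite ltr0n subn_gt0 (leq_ltn_trans kK).
have h2 : k%:R * l / (m - k)%:R / delta <= delta.
  rewrite ler_pdivrMr // ler_pdivrMr //.
  have hm : m%:R / 2 <= (m - k)%:R :> R by rewrite natrB //; lra.
  have hd : 0 <= delta * delta by rewrite mulr_ge0 // ltW.
  apply: (@le_trans _ _ (delta * delta * (m%:R / 2))); last by rewrite ler_wpM2l.
  have -> : delta * delta = (64 * z ^+ 2)^-1 by rewrite /delta /z; field; rewrite !gt_eqF.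
  have z64 : 0 < 64 * z ^+ 2 by have := exprn_gt0 2 z0; lra.
  rewrite mulrC ler_pdivlMl //.
  have zl0 : 0 <= z ^+ 2 * l by apply: mulr_ge0; [exact: sqr_ge0|exact: ltW].
  have h3 : k%:R * (z ^+ 2 * l) <= y * (z ^+ 2 * l).
    by rewrite ler_wpM2r // (le_trans kKR Ky).
  have h4 : 0 <= y * (z ^+ 2 * l) := mulr_ge0 (ltW y0) zl0.
  rewrite -/z in ym; lra.
have h3 : n%:R * (delta + k%:R * l / (m - k)%:R / delta + delta) <= n%:R * (delta + delta + delta).
  by rewrite ler_pM2l // lerD2r lerD2l.
lra.
Qed.

End ExchangeableCorruption.

(** * The adaptive maximum is at most the oblivious one *)

(** A list of neighbours is extended by a missing one as long as there is one; the degree stops this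
    before length d + 1. *)
Lemma neighbour_lists (R : realType) (T : countType) (rho : T -> T -> \bar R) (d : nat) :
  cost_degree rho d -> exists L : T -> seq T, forall t, (size (L t) <= d)%N /\
    forall y, rho t y != +oo%E -> y \in L t.
Proof.
move=> [deg _]; suff : forall t, exists l : seq T, (size l <= d)%N /\
    forall y, rho t y != +oo%E -> y \in l.
  by move=> /choice[L LP]; exists L.
move=> t; pose listed (s : seq T) := uniq s /\ forall y, y \in s -> rho t y != +oo%E.
suff claim k : (exists l : seq T, (size l <= d)%N /\
    forall y, rho t y != +oo%E -> y \in l) \/ exists s, listed s /\ size s = k.
  by have [//|[s [[us sP] sz]]] := claim d.+1; have := deg t s us sP; rewrite sz ltnn.
elim: k => [|k [|[s [[us sP] sk]]]]; [by right; exists [::]|by left|].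
have [complete|] := pselect (forall y, rho t y != +oo%E -> y \in s).
  by left; exists s; split=> //; exact: deg us sP.
move=> /existsNP[y /not_implyP[yt /negP ys]]; right; exists (y :: s).
split; last by rewrite /= sk.
split=> [|x]; first by rewrite /= ys.
by rewrite inE => /orP[/eqP ->|/sP].
Qed.

(** A uniform permutation restricted to n fixed indices is a uniform injection, so subsampling
    amounts to reading fixed coordinates of a permuted sample. The proof double counts pairs of a
    permutation and an injection. *)
Lemma sum_perm_subsample (R : realType) (n m : nat) (F : ('I_n -> 'I_m) -> R)
    (a : 'I_n -> 'I_m) : injective a ->
  (\sum_(sigma : {perm 'I_m}) F (sigma \o a)) / m`!%:R =
  (\sum_(iota : {ffun 'I_n -> 'I_m} | injectiveb iota) F iota) /
    #|[set iota : {ffun 'I_n -> 'I_m} | injectiveb iota]|%:R.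
Proof.
move=> aI; set c := #|_|.
have cE : c = #|[pred iota : {ffun 'I_n -> 'I_m} | injectiveb iota]|.
  by apply: eq_card => i; apply/idP/idP => /asboolP.
have c0 : c%:R != 0 :> R.
  rewrite pnatr_eq0 -lt0n cE; apply/card_gt0P; exists (finfun a).
  by rewrite inE; apply/injectiveP => i j; rewrite !ffunE => /aI.
have f0 : m`!%:R != 0 :> R by rewrite pnatr_eq0 -lt0n fact_gt0.
have same (b : 'I_n -> 'I_m) : injective b ->
    \sum_(sigma : {perm 'I_m}) F (sigma \o b) = \sum_(sigma : {perm 'I_m}) F (sigma \o a).
  move=> bI; have [|||tau tauE] := @perm_extend_seq 'I_m [seq a j | j <- enum 'I_n] [seq b j | j <- enum 'I_n].
  - by rewrite map_inj_uniq ?enum_uniq.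
  - by rewrite map_inj_uniq ?enum_uniq.
  - by rewrite !size_map.
  rewrite [RHS](reindex_inj (mulgI tau)) /=; apply: eq_bigr => sigma _.
  congr F; apply/funext => j /=; rewrite permM; congr (sigma _).
  move: tauE; rewrite -map_comp => /eq_in_map/(_ j) /= -> //.
  by rewrite mem_enum.
apply/eqP; rewrite eqr_div //; apply/eqP.
have -> : (\sum_(sigma : {perm 'I_m}) F (sigma \o a)) * c%:R =
    \sum_(iota : {ffun 'I_n -> 'I_m} | injectiveb iota) \sum_(sigma : {perm 'I_m}) F (sigma \o iota).
  rewrite [RHS](eq_bigr (fun=> \sum_(sigma : {perm 'I_m}) F (sigma \o a))).
    by rewrite sumr_const mulr_natr cE.
  by move=> iota /injectiveP; exact: same.
rewrite exchange_big /= (eq_bigr (fun=> \sum_(iota : {ffun 'I_n -> 'I_m} | injectiveb iota) F iota)).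
  by rewrite sumr_const mulr_natr card_Sn.
move=> sigma _; rewrite [RHS](reindex_inj (h := fun iota : {ffun 'I_n -> 'I_m} => [ffun j => sigma (iota j)])) /=.
  apply: eq_big => iota.
    apply/injectiveP/injectiveP => iI i j; first by rewrite !ffunE => /perm_inj /iI.
    by move=> ij; apply: iI; rewrite !ffunE ij.
  by move=> _; congr F; apply/funext => j; rewrite ffunE.
move=> i1 i2 /ffunP h; apply/ffunP => j; have := h j; rewrite !ffunE; exact: perm_inj.
Qed.

Section TotalMass.
Context {R : realType} {T : countType} (D : T -> R).
Hypothesis D_distr : is_distr D.

Lemma sum_inj_distr_le1 (V : finType) (e : V -> T) : injective e -> \sum_v D (e v) <= 1.
Proof.
move=> eI; rewrite -lee_fin -D_distr.2 -sumEFin.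
exact: (@sum_inj_le_esum R T (fun y => (D y)%:E) V e eI).
Qed.

Lemma prod_expect_le1 k (h : ('I_k -> T) -> \bar R) :
  (forall S, 0 <= h S)%E -> (forall S, h S <= 1)%E -> (prod_expect D h <= 1)%E.
Proof.
move=> h0 h1; apply: (prod_expect_le D_distr.1 h0 (s0 := [::])) => s us _.
apply: (@le_trans _ _ (\sum_(g : {ffun 'I_k -> seq_sub s}) (\prod_i D (@ssval T s (g i)))%:E)%E).
  apply: lee_sum => g _; rewrite -[leRHS]mule1 lee_wpmul2l // lee_fin.
  by apply: prodr_ge0 => i _; exact: D_distr.1.
rewrite sumEFin lee_fin (sum_prod_ffunT (fun _ v => D (@ssval T s v))) prodr_const.
apply: exprn_ile1; first by apply: sumr_ge0 => v _; exact: D_distr.1.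
exact/sum_inj_distr_le1/val_inj.
Qed.

Lemma prod_expect_ge0 k (h : ('I_k -> T) -> \bar R) :
  (forall S, 0 <= h S)%E -> (0 <= prod_expect D h)%E.
Proof.
move=> h0; apply: esum_ge0 => S _; apply: mule_ge0 => //.
by rewrite lee_fin; apply: prodr_ge0 => i _; exact: D_distr.1.
Qed.

End TotalMass.

Section AdaptiveLeOblivious.
Context {R : realType} {T : countType} (rho : T -> T -> \bar R) (D : T -> R).
Context (n m : nat) (f : ('I_n -> T) -> bool).
Hypothesis rho_cost : is_cost rho.
Hypothesis D_distr : is_distr D.

Lemma ObliviousMax_le1 : (ObliviousMax rho f D <= 1)%E.
Proof.
apply: ge_ereal_sup => _ [D' [D'distr _] <-].
by apply: prod_expect_le1 => // S; rewrite lee_fin ?lern1 ?leq_b1.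
Qed.

Lemma ObliviousMax_ge0 : (0 <= ObliviousMax rho f D)%E.
Proof.
(* The empty subcoupling, completed by leaving all of D in place, provides the lower bound 0. *)
have z0 (z : void) : 0 <= of_void R z by case: z.
have zD t : \sum_(z | of_void T z == t) of_void R z <= D t.
  by rewrite big1 ?D_distr.1 // => -[].
have zc : (\sum_z (of_void R z)%:E * rho (of_void T z) (of_void T z) <= 1)%E.
  by rewrite big1 ?lee_fin // => -[].
apply: le_trans (subcoupling_le_ObliviousMax rho_cost D_distr z0 zD zc f).
by rewrite lee_fin sumr_ge0 // => g _; rewrite mulr_ge0 // prodr_ge0.
Qed.

Lemma ObliviousMax_fin : (fine (ObliviousMax rho f D))%:E = ObliviousMax rho f D.
Proof.
rewrite fineK // ge0_fin_numE ?ObliviousMax_ge0 //.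
by apply: le_lt_trans ObliviousMax_le1 _; rewrite ltry.
Qed.

Hypothesis n_gt0 : (0 < n)%N.
Hypothesis m_gt0 : (0 < m)%N.
Context (d : nat) (eps : R).
Hypothesis rho_deg : cost_degree rho d.
Hypothesis d_gt1 : (1 < d)%N.
Hypothesis eps_gt0 : 0 < eps.
Hypothesis eps_le1 : eps <= 1.
Hypothesis m_big : 2 ^+ 17 * n%:R ^+ 4 * (ln d%:R) ^+ 2 / eps ^+ 4 <= m%:R.

Let pg (S : 'I_m -> T) : R := subsample_prob f S.
Let pg_ge0 S : 0 <= pg S. Proof. exact: subsample_prob_ge0. Qed.
Let pg_le1 S : pg S <= 1. Proof. exact: subsample_prob_le1. Qed.
Let g := adaptive_sup rho pg.

Lemma adaptive_sup_finite_le (V : finType) (emb : V -> T) :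
  injective emb -> (forall v, 0 < D (emb v)) ->
  1 - eps / (8 * n%:R) <= \sum_v D (emb v) ->
  \sum_(S : {ffun 'I_m -> V}) (\prod_i D (emb (S i))) * g (emb \o S) <=
  fine (ObliviousMax rho f D) + 7 / 8 * eps.
Proof.
move=> embI D0; set M := \sum_v D (emb v) => Mbig.
have nR0 : 0 < n%:R :> R by rewrite ltr0n.
have n1 : 1 <= n%:R :> R by rewrite ler1n.
have e0 := eps_gt0; have e1 := eps_le1.
have delta1 : eps / (8 * n%:R) < 1.
  by rewrite ltr_pdivrMr ?mulr_gt0 //; lra.
have M0 : 0 < M by lra.
have M1 : M <= 1 by apply: sum_inj_distr_le1.
(* D conditioned on the finite alphabet. It is positive there, as the entropy argument requires a
   sample space without null points. *)
pose Dh t := if [exists v, emb v == t] then D t / M else 0.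
have Dh_emb v : Dh (emb v) = D (emb v) / M.
  by rewrite /Dh; case: ifP => // /existsP[]; exists v.
have Dh_ge0 t : 0 <= Dh t.
  by rewrite /Dh; case: ifP => // _; rewrite divr_ge0 ?D_distr.1 // ltW.
have Dh_gt0 v : 0 < Dh (emb v) by rewrite Dh_emb divr_gt0.
have Dh_sum1 : \sum_v Dh (emb v) = 1.
  by under eq_bigr do rewrite Dh_emb; rewrite -mulr_suml divff // gt_eqF.
have Dh_sub1 s : uniq s -> \sum_(t <- s) Dh t <= 1.
  move=> us; rewrite -Dh_sum1 -big_mkcond -big_filter -lee_fin -!sumEFin.
  rewrite (eq_bigr (fun v => (D (emb v) / M)%:E)); last by move=> v _; rewrite Dh_emb.
  apply: (@sum_seq_le_cover R T (fun t => (D t / M)%:E) _ V emb) => [t||t].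
  - by rewrite lee_fin divr_ge0 ?D_distr.1 // ltW.
  - exact: filter_uniq.
  - by rewrite mem_filter => /andP[/existsP[v /eqP <-] _]; exists v.
(* [sel] is the adversary's answer, optimal up to eps / 8; with the 3 eps / 4 of
   [exists_close_sample] this makes 7 eps / 8. *)
have /choice[sel selP] : forall S : 'I_m -> T,
    exists S', cost_ball rho S S' /\ g S <= pg S' + eps / 8.
  move=> S; have e8 : 0 < eps / 8 by rewrite divr_gt0.
  have [S' h1 h2] := adaptive_sup_approx rho_cost pg_le1 S e8.
  by exists S'.
pose Omega := ({ffun 'I_m -> V} * {perm 'I_m})%type.
pose P (w : Omega) : R := (\prod_i Dh (emb (w.1 i))) / m`!%:R.
have fm0 : 0 < m`!%:R :> R by rewrite ltr0n fact_gt0.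
have P_gt0 w : 0 < P w.
  by apply: divr_gt0 => //; apply: prodr_gt0 => i _; exact: Dh_gt0.
have sumPE (F : Omega -> R) : \sum_w P w * F w =
    \sum_(S : {ffun 'I_m -> V}) (\prod_i Dh (emb (S i))) *
      ((\sum_(sigma : {perm 'I_m}) F (S, sigma)) / m`!%:R).
  transitivity (\sum_(S : {ffun 'I_m -> V}) \sum_(sigma : {perm 'I_m}) P (S, sigma) * F (S, sigma)).
    by rewrite pair_bigA; apply: eq_bigr => -[].
  apply: eq_bigr => S _; rewrite mulr_suml mulr_sumr; apply: eq_bigr => sigma _.
  by rewrite /P /=; ring.
have P_sum1 : \sum_w P w = 1.
  under eq_bigr do rewrite -[P _]mulr1.
  rewrite sumPE sumr_const card_Sn -[1 *+ _]/(m`!%:R) divff ?gt_eqF //.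
  under eq_bigr do rewrite mulr1.
  by rewrite (sum_prod_ffunT (fun _ v => Dh (emb v))) big1.
pose X (i : 'I_m) (w : Omega) := emb (w.1 (w.2 i)).
pose Y (i : 'I_m) (w : Omega) := sel (emb \o w.1) (w.2 i).
(* The product acts with [tau] first, so [X] and [Y] get their index replaced by [tau i]; the same
   permutation shuffles the sample and the answer. *)
pose act (tau : {perm 'I_m}) (w : Omega) : Omega := (w.1, (tau * w.2)%g).
have act_inj tau : injective (act tau).
  by move=> [S1 s1] [S2 s2] [-> /mulgI ->].
have prodX w : \prod_i Dh (X i w) = \prod_i Dh (emb (w.1 i)).
  by rewrite [RHS](reindex_inj (@perm_inj _ w.2)).
have pr_X w : pr P (fun w => [seq X i w | i <- enum 'I_m]) w <= \prod_i Dh (X i w).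
  rewrite /pr.
  have cl w' : [seq X i w' | i <- enum 'I_m] = [seq X i w | i <- enum 'I_m] ->
      forall i, X i w' = X i w.
    by move=> /eq_in_map h i; apply: h; rewrite mem_enum.
  set K := \prod_i Dh (X i w).
  have K0 : 0 <= K by apply: prodr_ge0.
  pose Q (w' : Omega) := [seq X i w' | i <- enum 'I_m] == [seq X i w | i <- enum 'I_m].
  rewrite (eq_bigr (fun=> K / m`!%:R)) => [|w' /eqP/cl h]; last first.
    by rewrite /P -prodX /K; under eq_bigr do rewrite h.
  rewrite sumr_const -(mulr_natr (K / m`!%:R)) mulrAC ler_pdivrMr // ler_wpM2l // ler_nat.
  (* Given the values of all [X i], the permutation determines the sample, so an atom has at most m!
     points, each of weight K / m!. *)
  rewrite -(card_Sn m) -(@card_in_imset _ _ snd [pred w' | Q w']) ?max_card //.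
  move=> [S1 s1] [S2 s2] /eqP/cl h1 /eqP/cl h2 /= s12; rewrite -s12 in h2 *; congr pair.
  apply/ffunP => i; apply: embI.
  by have := h1 (s1^-1 i)%g; rewrite -h2 /X /= permKV.
have ball_sum (S : 'I_m -> T) : (\sum_i rho (S i) (sel S i) <= (m%:R)%:E)%E.
  have := (selP S).1; rewrite /cost_ball lee_pdivrMl ?ltr0n //.
  by rewrite mule1.
have rho_fin (S : 'I_m -> T) i : rho (S i) (sel S i) \is a fin_num.
  rewrite ge0_fin_numE ?rho_cost.1 //.
  apply: le_lt_trans (ltry m%:R); apply: le_trans (ball_sum S).
  by rewrite (bigD1 i) //= leeDl // sume_ge0 // => j _; exact: rho_cost.1.
pose c (i : 'I_m) (w : Omega) := fine (rho (X i w) (Y i w)).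
have c_rho i w : rho (X i w) (Y i w) = (c i w)%:E by rewrite fineK // rho_fin.
have c_ge0 i w : 0 <= c i w by rewrite fine_ge0 // rho_cost.1.
have c_budget w : \sum_i c i w <= m%:R.
  rewrite -lee_fin -sumEFin; apply: le_trans (ball_sum (emb \o w.1)).
  rewrite [leRHS](reindex_inj (@perm_inj _ w.2)) /=; apply: lee_sum => i _.
  by rewrite -c_rho.
have [L LP] := neighbour_lists rho_deg.
have Y_L i w : Y i w \in L (X i w).
  by apply: (LP _).2; rewrite c_rho.
have Dh_D t : (1 - eps / (8 * n%:R)) * Dh t <= D t.
  rewrite /Dh; case: ifP => _; last by rewrite mulr0 D_distr.1.
  rewrite mulrA ler_pdivrMr // [leRHS]mulrC ler_wpM2r ?D_distr.1 //.
have obl (u : Omega -> R) (x y : Omega -> T) :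
    (forall w, 0 <= u w) -> (forall t, \sum_(w | x w == t) u w <= D t) ->
    (\sum_w (u w)%:E * rho (x w) (y w) <= 1)%E ->
    \sum_(h : {ffun 'I_n -> Omega}) (\prod_i u (h i)) * (f (fun i => y (h i)))%:R <=
    fine (ObliviousMax rho f D).
  move=> u0 ux uc; rewrite -lee_fin ObliviousMax_fin.
  exact: (subcoupling_le_ObliviousMax rho_cost D_distr u0 ux uc f).
have [a aI close] := @exists_close_sample R T Omega P P_gt0 P_sum1 m X Y act act_inj
  (fun tau w => erefl) (fun tau i w => congr1 (fun j => emb (w.1 j)) (permM tau w.2 i))
  (fun tau i w => congr1 (sel (emb \o w.1)) (permM tau w.2 i))
  Dh Dh_ge0 Dh_sub1 (fun i w => Dh_gt0 _) pr_X rho c L d (ltnW d_gt1)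
  (fun t => (LP t).1) Y_L c_ge0 c_rho c_budget n f D (fine (ObliviousMax rho f D)) eps
  n_gt0 d_gt1 eps_gt0 eps_le1 m_big Dh_D obl.
move: close; rewrite sumPE.
rewrite (eq_bigr (fun S : {ffun 'I_m -> V} =>
   (\prod_i Dh (emb (S i))) * pg (sel (emb \o S)))); last first.
  move=> S _; congr (_ * _); rewrite /pg /subsample_prob.
  by rewrite -(@sum_perm_subsample R n m (fun b => (f (sel (emb \o S) \o b))%:R) a aI).
move=> close.
apply: (@le_trans _ _ (\sum_(S : {ffun 'I_m -> V})
   (\prod_i Dh (emb (S i))) * (pg (sel (emb \o S)) + eps / 8))).
  apply: ler_sum => S _.
  have gS := (selP (emb \o S)).2.
  have h0 : 0 <= g (emb \o S) by exact: adaptive_sup_ge0 rho_cost pg_ge0 pg_le1 _.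
  have DDh : \prod_i D (emb (S i)) <= \prod_i Dh (emb (S i)).
    by apply: ler_prod => i _; rewrite Dh_emb (ltW (D0 _)) ler_peMr ?invf_ge1 ?(ltW (D0 _)).
  apply: (le_trans (ler_wpM2r h0 DDh)); apply: ler_wpM2l => //.
  by apply: prodr_ge0 => i _.
under eq_bigr do rewrite mulrDr.
have PS1 : \sum_(S : {ffun 'I_m -> V}) \prod_i Dh (emb (S i)) = 1.
  by rewrite (sum_prod_ffunT (fun _ v => Dh (emb v))) big1.
rewrite big_split /= -mulr_suml PS1 mul1r.
have := eps_gt0.
lra.
Qed.

Lemma AdaptiveMax_le_ObliviousMax :
  (AdaptiveMax rho pg D <= ObliviousMax rho f D + eps%:E)%E.
Proof.
rewrite (AdaptiveMaxE rho_cost pg_le1) -/g -ObliviousMax_fin -EFinD.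
have g0 S : (0 <= (g S)%:E)%E.
  by rewrite lee_fin; exact: adaptive_sup_ge0 rho_cost pg_ge0 pg_le1 _.
have e0 := eps_gt0.
have dl0 : 0 < eps / (8 * n%:R) by rewrite divr_gt0 // mulr_gt0 // ltr0n.
have [G uG Gbig] := esum_approx D_distr.2 dl0.
apply: (prod_expect_le D_distr.1 g0 (s0 := G)) => s us Gs.
(* Points of mass zero are removed from the alphabet; tuples containing one contribute nothing to
   the expectation. *)
pose V := {x : seq_sub s | 0 < D (ssval x)}.
pose emb (v : V) := ssval (val v).
have embI : injective emb by move=> v w /val_inj/val_inj.
have D0 (v : V) : 0 < D (emb v) by exact: (valP v).
have Mbig : 1 - eps / (8 * n%:R) <= \sum_v D (emb v).
  apply: (le_trans Gbig); rewrite (bigID (fun x => 0 < D x)) /= [X in _ + X]big1 ?addr0.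
    rewrite -big_filter -lee_fin -!sumEFin.
    apply: (@sum_seq_le_cover R T (fun t => (D t)%:E) _ V emb) => [t||t].
    - by rewrite lee_fin D_distr.1.
    - exact: filter_uniq.
    - rewrite mem_filter => /andP[Dt /Gs ts].
      by exists (exist (fun x : seq_sub s => 0 < D (ssval x)) (SeqSub ts) Dt).
  by move=> t; rewrite -leNgt => h; apply/eqP; rewrite eq_le h D_distr.1.
apply: (@le_trans _ _ (fine (ObliviousMax rho f D) + 7 / 8 * eps)%:E); last first.
  by rewrite lee_fin lerD2l; lra.
have := adaptive_sup_finite_le embI D0 Mbig; rewrite -lee_fin; apply: le_trans.
rewrite -sumEFin; under [leRHS]eq_bigr do rewrite EFinM.
pose pos (h : {ffun 'I_m -> seq_sub s}) := [forall i, 0 < D (ssval (h i))].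
rewrite (bigID pos) /= [X in (_ + X)%E]big1 ?adde0; last first.
  move=> h; rewrite negb_forall => /existsP[i]; rewrite -leNgt => hi.
  have Dhi : D (ssval (h i)) = 0 by apply/eqP; rewrite eq_le hi D_distr.1.
  by rewrite (bigD1 i) //= Dhi mul0r mul0e.
pose a (h : {ffun 'I_m -> seq_sub s}) :=
  ((\prod_i D (ssval (h i)))%:E * (g (@ssval T s \o h))%:E)%E.
pose ext (S : {ffun 'I_m -> V}) : {ffun 'I_m -> seq_sub s} := [ffun i => val (S i)].
rewrite -big_filter [leRHS](eq_bigr (fun S => a (ext S))) => [|S _]; last first.
  rewrite /a (_ : @ssval T s \o ext S = emb \o S); last first.
    by apply/funext => i; rewrite /= ffunE.
  by congr (_%:E * _)%E; apply: eq_bigr => i _; rewrite ffunE.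
apply: (@sum_seq_le_cover R _ a _ _ ext) => [h||h].
- by rewrite /a mule_ge0 // lee_fin prodr_ge0 // => i _; exact: D_distr.1.
- exact/filter_uniq/index_enum_uniq.
- rewrite mem_filter => /andP[/forallP hpos _].
  exists [ffun i => exist (fun x : seq_sub s => 0 < D (ssval x)) (h i) (hpos i)].
  by apply/ffunP => i; rewrite !ffunE.
Qed.

End AdaptiveLeOblivious.

Theorem mainTheorem1 (R : realType) :
  exists C : R, 0 < C /\
  forall (T : countType) (x0 : T) (n : nat) (eps : R)
         (rho : T -> T -> \bar R) (d m : nat)
         (f : ('I_n -> T) -> bool) (D : T -> R),
    (1 <= n)%N -> 0 < eps -> eps <= 1 ->
    is_cost rho -> cost_degree rho d -> (2 <= d)%N ->
    C * n%:R ^+ 4 * (ln d%:R) ^+ 2 / eps ^+ 4 <= m%:R ->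
    is_distr D ->
    (`| ObliviousMax rho f D - AdaptiveMax rho (subsample_prob (m:=m) f) D | <= eps%:E)%E.
Proof.
exists (2 ^+ 17); split; first by rewrite exprn_gt0.
move=> T x0 n eps rho d m f D n0 e0 e1 rho_cost deg d1 mbig Ddistr.
have n1 : 1 <= n%:R :> R by rewrite ler1n.
have nR0 : 0 < n%:R :> R by rewrite ltr0n.
have e40 : 0 < eps ^+ 4 by apply: exprn_gt0.
have e41 : eps ^+ 4 <= 1 by apply: exprn_ile1 => //; apply: ltW.
have n30 : 0 < n%:R ^+ 3 :> R by apply: exprn_gt0.
(* As d >= 2 gives (ln d)^2 >= 1/4, the bound with 2^17 implies the one that the other direction
   asks for. *)
have mbig' : 2 ^+ 15 * n%:R ^+ 3 / eps ^+ 4 <= m%:R.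
  apply: le_trans mbig; rewrite ler_pM2r ?invr_gt0 //.
  have h : 1 / 4 <= (ln d%:R) ^+ 2 :> R.
    have -> : 1 / 4 = (1 / 2) ^+ 2 :> R by field.
    by rewrite lerXn2r ?nnegrE ?ln_ge_half // (le_trans _ (ln_ge_half R d1)).
  have n34 : n%:R ^+ 3 <= n%:R ^+ 4 :> R by rewrite [leRHS]exprS ler_peMl // ltW.
  have h1 : n%:R ^+ 3 * (1 / 4) <= n%:R ^+ 4 * (ln d%:R) ^+ 2 :> R.
    by apply: ler_pM => //; rewrite ltW.
  have -> : 2 ^+ 15 * n%:R ^+ 3 = 2 ^+ 17 * (n%:R ^+ 3 * (1 / 4)) :> R by field.
  by rewrite -mulrA ler_pM2l // exprn_gt0.
have nm' : n%:R <= m%:R :> R.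
  apply: le_trans mbig'; rewrite ler_pdivlMr //.
  have n13 : n%:R <= n%:R ^+ 3 :> R by rewrite -[leLHS]expr1 ler_weXn2l.
  have ne : n%:R * eps ^+ 4 <= n%:R by rewrite ler_piMr.
  have p15 : n%:R ^+ 3 <= 2 ^+ 15 * n%:R ^+ 3 :> R.
    by rewrite ler_peMl ?(ltW n30) // exprn_ege1 // ler1n.
  by apply: (le_trans ne); apply: (le_trans n13).
have nm : (n <= m)%N by rewrite -(ler_nat R).
have m0 : (0 < m)%N by apply: leq_trans nm.
have OA := ObliviousMax_le_AdaptiveMax f rho_cost Ddistr.1 m0 nm Ddistr n0 e0 e1 mbig'.
have AO := AdaptiveMax_le_ObliviousMax f rho_cost Ddistr n0 m0 deg d1 e0 e1 mbig.
have Afin : AdaptiveMax rho (subsample_prob (m:=m) f) D \is a fin_num.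
  rewrite (AdaptiveMaxE rho_cost (@subsample_prob_le1 R T n m f)).
  have g0 S : (0 <= (adaptive_sup rho (subsample_prob (m:=m) f) S)%:E :> \bar R)%E.
    by rewrite lee_fin; exact: adaptive_sup_ge0 rho_cost (subsample_prob_ge0 f) (subsample_prob_le1 f) S.
  have g1 S : ((adaptive_sup rho (subsample_prob (m:=m) f) S)%:E <= 1 :> \bar R)%E.
    by rewrite lee_fin; exact: adaptive_sup_le1 rho_cost (subsample_prob_le1 f) S.
  rewrite ge0_fin_numE; last exact: prod_expect_ge0.
  exact: (le_lt_trans (prod_expect_le1 Ddistr g0 g1) (ltry _)).
rewrite -(ObliviousMax_fin f rho_cost Ddistr) in OA AO *.
rewrite -(fineK Afin) in OA AO *; move: OA AO.
by rewrite -EFinB abse_EFin -!EFinD !lee_fin ler_distl => OA AO; apply/andP; split; lra.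
Qed.
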